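(* Let $q\in(-1,1)$, $q\neq0$, and let $A_q=C(SU_q(2))$. Let $\lambda_q$ be the GNS representation of $A_q$ on $L^2(SU_q(2))$ for the Haar state, let $\pi_q$ be the representation of $A_q$ on $\mathcal{H}_\pi=\ell^2(\mathbb{N})\otimes\ell^2(\mathbb{Z})$ described in the context, let $\mathcal{H}_{mult}=\ell^2(\mathbb{N})$, and let $\mathscr{T}\subseteq\mathcal{L}(\mathcal{H}_{mult})$ be the Toeplitz algebra. Then there is a unitary $U:L^2(SU_q(2))\to\mathcal{H}_{mult}\otimes\mathcal{H}_\pi$ such that the pair $$\bigl(U\lambda_q(\cdot)U^*,\ I\otimes\pi_q(\cdot)\bigr)$$ is a quasihomomorphism from $A_q$ to $\mathscr{T}\otimes\mathcal{K}(\mathcal{H}_\pi)$, and hence gives a $KK$-class in the group $KK(A_q,\mathscr{T})$.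
   Context: $\mathbb{N}=\{0,1,2,\ldots\}$; $\mathcal{L}$ and $\mathcal{K}$ denote bounded and compact operators, and $M(\cdot)$ the multiplier algebra. $\mathscr{T}$ is the $C^*$-algebra on $\ell^2(\mathbb{N})$ generated by the unilateral shift. Tensor products of $C^*$-algebras are spatial, and $M(\mathscr{T}\otimes\mathcal{K}(\mathcal{H}_\pi))$ is realized as operators on $\mathcal{H}_{mult}\otimes\mathcal{H}_\pi$. Quasihomomorphism (Cuntz picture): for $C^*$-algebras $A$, $B$ and a separable infinite-dimensional Hilbert space $\mathcal{H}$, a pair $(\varphi,\psi)$ of $*$-homomorphisms $A\to M(B\otimes\mathcal{K}(\mathcal{H}))$ such that $\varphi(a)-\psi(a)\in B\otimes\mathcal{K}(\mathcal{H})$ for all $a\in A$. Such a pair defines an element of $KK(A,B)$. $A_q=C(SU_q(2))$ is the universal unital $C^*$-algebra generated by $\alpha_q,\beta_q$ (written $\alpha,\beta$ here) with relations $$\alpha^*\alpha+\beta^*\beta=I,\quad \alpha\alpha^*+q^2\beta\beta^*=I,\quad \alpha\beta=q\beta\alpha,\quad \alpha\beta^*=q\beta^*\alpha,\quad \beta^*\beta=\beta\beta^*.$$ Representation $\pi_q$ on $\mathcal{H}_\pi=\ell^2(\mathbb{N})\otimes\ell^2(\mathbb{Z})$: $\pi_q(\alpha_q)=S\sqrt{I-q^{2N}}\otimes I$ and $\pi_q(\beta_q)=q^N\otimes S$. Here on $\ell^2(\mathbb{N})$, $Ne_k=ke_k$, and $S$ is the left shift ($Se_k=e_{k-1}$ for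 $k\ge1$, $Se_0=0$), while on $\ell^2(\mathbb{Z})$, $S$ denotes $e_k\mapsto e_{k-1}$. The GNS space $L^2(SU_q(2))$ of the Haar state is identified with $\ell^2(\Gamma)$, $\Gamma=\{(n,i,j): n\in\frac12\mathbb{N},\ i,j\in\{-n,-n+1,\ldots,n\}\}$, through the orthonormal basis $e^n_{ij}$ of normalized matrix entries of the irreducible unitary (co)representations of $SU_q(2)$. In this basis the GNS representation (left multiplication) $\lambda_q$ is given by $$\lambda_q(\alpha_q)e^n_{ij}=a_+(n,i,j)e^{n+\frac12}_{i-\frac12,j-\frac12}+a_-(n,i,j)e^{n-\frac12}_{i-\frac12,j-\frac12},$$ $$\lambda_q(\beta_q)e^n_{ij}=b_+(n,i,j)e^{n+\frac12}_{i+\frac12,j-\frac12}+b_-(n,i,j)e^{n-\frac12}_{i+\frac12,j-\frac12},$$ where, with $g(k)=(1-q^{2k})^{1/2}$, $$a_+(n,i,j)=q^{2n+i+j+1}\frac{g(n-j+1)g(n-i+1)}{g(2n+1)g(2n+2)},\qquad a_-(n,i,j)=\frac{g(n+j)g(n+i)}{g(2n)g(2n+1)},$$ $$b_+(n,i,j)=-q^{n+j}\frac{g(n-j+1)g(n+i+1)}{g(2n+1)g(2n+2)},\qquad b_-(n,i,j)=q^{n+i}\frac{g(n+j)g(n-i)}{g(2n)g(2n+1)}.$$ For $n=0$, $a_-$ and $b_-$ are taken to be $0$. Terms whose basis vector index lies outside $\Gamma$ have coefficient $0$. *)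

(* Defs.v *)
From HB Require Import structures.
From mathcomp Require Import all_boot all_order all_algebra.
From mathcomp Require Import complex lra ring.
From mathcomp Require Import all_classical all_reals all_analysis.
Import Order.TTheory GRing.Theory Num.Theory.
Import numFieldNormedType.Exports.
Set Implicit Arguments. Unset Strict Implicit. Unset Printing Implicit Defensive.
Local Open Scope classical_set_scope.
Local Open Scope ring_scope.
Local Open Scope complex_scope.

Section SquareSummable.
Variables (R : realType) (I : choiceType).
Implicit Types (f g : I -> R[i]) (z : R[i]).

(** [nrm2 z] is |z|^2 as a real number; the norm of R[i] takes values in R[i]. *)
Definition nrm2 z : R := complex.Re z ^+ 2 + complex.Im z ^+ 2.

Definition sqsum f : \bar R := (\esum_(i in [set: I]) (nrm2 (f i))%:E)%E.

Definition sqsummable : pred (I -> R[i]) := fun f => (sqsum f < +oo)%E.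

Lemma nrm2_ge0 z : 0 <= nrm2 z.
Proof. by rewrite addr_ge0 ?sqr_ge0. Qed.

Lemma nrm2E z : (nrm2 z)%:C = `|z| ^+ 2.
Proof. exact: add_Re2_Im2. Qed.

Lemma nrm2M z w : nrm2 (z * w) = nrm2 z * nrm2 w.
Proof. case: z w => [a b] [c d]; rewrite /nrm2 /=; ring. Qed.

Lemma nrm2D_le t z w : 0 < t ->
  nrm2 (z + w) <= (1 + t) * nrm2 z + (1 + t^-1) * nrm2 w.
Proof.
move=> t0; case: z w => [a b] [c d]; rewrite /nrm2 /= -subr_ge0.
suff -> : (1 + t) * (a ^+ 2 + b ^+ 2) + (1 + t^-1) * (c ^+ 2 + d ^+ 2)
   - ((a + c) ^+ 2 + (b + d) ^+ 2) =
   t^-1 * ((t * a - c) ^+ 2 + (t * b - d) ^+ 2).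
  by rewrite mulr_ge0 ?invr_ge0 ?(ltW t0)// addr_ge0 ?sqr_ge0.
by field; rewrite gt_eqF.
Qed.

Lemma sqsum_ge0 f : (0 <= sqsum f)%E.
Proof. by apply: esum_ge0 => i _; rewrite lee_fin nrm2_ge0. Qed.

Lemma sqsummableP f : reflect (exists M, (sqsum f <= M%:E)%E) (sqsummable f).
Proof.
apply: (iffP idP) => [fo|[M]]; last by move/le_lt_trans; apply; rewrite ltry.
by exists (fine (sqsum f)); rewrite fineK // ge0_fin_numE // sqsum_ge0.
Qed.

Lemma nrm2_le_sqsum f i : ((nrm2 (f i))%:E <= sqsum f)%E.
Proof.
apply: esum_ge; exists [set i]; first by split=> //; exact: finite_set1.
by rewrite fsbig_set1.
Qed.

Lemma sqsum_leP f M : (forall X : set I, finite_set X ->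
    \sum_(i \in X) nrm2 (f i) <= M) <-> (sqsum f <= M%:E)%E.
Proof.
split=> [H|H X fX].
  by apply: ge_ereal_sup => _ [X [fX _] <-]; rewrite fsumEFin// lee_fin H.
rewrite -lee_fin; apply: le_trans H; apply: esum_ge; exists X => //.
by rewrite fsumEFin.
Qed.

Lemma sqsumZ_le c f M : (sqsum f <= M%:E)%E ->
  (sqsum (c \*: f) <= (nrm2 c * M)%:E)%E.
Proof.
move/sqsum_leP => H; apply/sqsum_leP => X fX.
under eq_fsbigr do rewrite nrm2M.
by rewrite -mulr_fsumr ler_wpM2l ?nrm2_ge0 ?H.
Qed.

Lemma sqsumD_le t f g M N : 0 < t -> (sqsum f <= M%:E)%E ->
  (sqsum g <= N%:E)%E -> (sqsum (f \+ g)%R <= ((1 + t) * M + (1 + t^-1) * N)%:E)%E.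
Proof.
move=> t0 /sqsum_leP Hf /sqsum_leP Hg; apply/sqsum_leP => X fX.
have /le_trans : \sum_(i \in X) nrm2 ((f \+ g) i) <=
  \sum_(i \in X) ((1 + t) * nrm2 (f i) + (1 + t^-1) * nrm2 (g i)).
  by rewrite !fsbig_finite //=; apply: ler_sum => i _; exact: nrm2D_le.
apply; rewrite fsbig_split //= -!mulr_fsumr lerD // ler_wpM2l ?Hf ?Hg //.
  by rewrite addr_ge0 // ltW.
by rewrite addr_ge0 // invr_ge0 ltW.
Qed.

Lemma sqsummable_submod : submod_closed sqsummable.
Proof.
split=> [|c f g /sqsummableP[M fM] /sqsummableP[N gN]]; apply/sqsummableP.
  exists 0; apply/sqsum_leP => X _; rewrite fsbig1 // => i _.
  by rewrite /nrm2 /= expr0n /= addr0.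
exists ((1 + 1) * (nrm2 c * M) + (1 + 1^-1) * N).
exact: (@sqsumD_le 1 _ _ _ _ ltr01 (sqsumZ_le c fM) gN).
Qed.

HB.instance Definition _ :=
  GRing.isSubmodClosed.Build R[i] (I -> R[i]) sqsummable sqsummable_submod.

Record l2 := L2 { l2val :> I -> R[i]; _ : l2val \in sqsummable }.

HB.instance Definition _ := [isSub for l2val].
HB.instance Definition _ := [Choice of l2 by <:].
HB.instance Definition _ := [SubChoice_isSubLmodule of l2 by <:].

Definition l2norm (x : l2) : R := Num.sqrt (fine (sqsum x)).

Lemma l2P (x y : l2) : (forall i, x i = y i) -> x = y.
Proof. by move=> H; apply: val_inj; apply/funext. Qed.

Lemma sqsum_l2 (x : l2) : sqsum x = (l2norm x ^+ 2)%:E.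
Proof.
have xo : (sqsum x < +oo)%E by exact: (valP x).
rewrite /l2norm sqr_sqrtr ?fine_ge0 ?sqsum_ge0 // fineK //.
by rewrite ge0_fin_numE // sqsum_ge0.
Qed.

Lemma l2norm_ge0 x : 0 <= l2norm x. Proof. exact: sqrtr_ge0. Qed.

Lemma l2norm_leP x M : 0 <= M ->
  (l2norm x <= M) <-> (sqsum x <= (M ^+ 2)%:E)%E.
Proof. by move=> M0; rewrite sqsum_l2 lee_fin ler_sqr ?nnegrE ?l2norm_ge0. Qed.

Lemma nrm2_le_l2norm (x : l2) i : nrm2 (x i) <= l2norm x ^+ 2.
Proof. by rewrite -lee_fin -sqsum_l2 nrm2_le_sqsum. Qed.

Lemma l2norm_eq0 x : l2norm x = 0 -> x = 0.
Proof.
move=> x0; apply: l2P => i; have := nrm2_le_l2norm x i.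
rewrite x0 expr0n /= => h.
have : nrm2 (x i) = 0 by apply/eqP; rewrite eq_le h nrm2_ge0.
by move=> /(congr1 (fun r => r%:C)); rewrite nrm2E => /eqP; rewrite expf_eq0 /= normr_eq0 => /eqP.
Qed.

Lemma l2normD x y : l2norm (x + y) <= l2norm x + l2norm y.
Proof.
have [x0|x0] := eqVneq (l2norm x) 0; first by rewrite x0 (l2norm_eq0 x0) !add0r.
have [y0|y0] := eqVneq (l2norm y) 0; first by rewrite y0 (l2norm_eq0 y0) !addr0.
have gx : 0 < l2norm x by rewrite lt_def x0 l2norm_ge0.
have gy : 0 < l2norm y by rewrite lt_def y0 l2norm_ge0.
apply/l2norm_leP; first by rewrite addr_ge0 ?l2norm_ge0.
have := @sqsumD_le (l2norm y / l2norm x) x y (l2norm x ^+ 2) (l2norm y ^+ 2) (divr_gt0 gy gx).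
rewrite !sqsum_l2 => /(_ (lexx _) (lexx _)).
rewrite -sqsum_l2; congr (_ <= _%:E)%E.
by field; rewrite x0 y0.
Qed.

Lemma nrm2_l2 c : (Num.sqrt (nrm2 c))%:C = `|c|.
Proof. by case: c. Qed.

Lemma l2normZ_le c x : l2norm (c *: x) <= Num.sqrt (nrm2 c) * l2norm x.
Proof.
apply/l2norm_leP; first by rewrite mulr_ge0 ?sqrtr_ge0 ?l2norm_ge0.
rewrite exprMn sqr_sqrtr ?nrm2_ge0//.
by apply: (@sqsumZ_le c x); rewrite sqsum_l2.
Qed.

Lemma l2normZ c x : l2norm (c *: x) = Num.sqrt (nrm2 c) * l2norm x.
Proof.
apply/eqP; rewrite eq_le l2normZ_le /=.
have [->|c0] := eqVneq c 0.
  by rewrite {1}/nrm2 /= expr0n /= addr0 sqrtr0 mul0r l2norm_ge0.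
have cV : Num.sqrt (nrm2 c) * Num.sqrt (nrm2 c^-1) = 1.
  by rewrite -sqrtrM ?nrm2_ge0// -nrm2M divff// /nrm2 /= expr1n expr0n addr0 sqrtr1.
have := l2normZ_le c^-1 (c *: x); rewrite scalerA mulVf // scale1r => h.
rewrite (le_trans (ler_wpM2l (sqrtr_ge0 _) h)) //.
by rewrite mulrA cV mul1r.
Qed.

Let normD (x y : l2) : (l2norm (x + y))%:C <= (l2norm x)%:C + (l2norm y)%:C.
Proof. by rewrite -rmorphD lecR l2normD. Qed.

Let normZ (c : R[i]) (x : l2) : (l2norm (c *: x))%:C = `|c| * (l2norm x)%:C.
Proof. by rewrite l2normZ rmorphM /= nrm2_l2. Qed.

Let norm0_eq0 (x : l2) : (l2norm x)%:C = 0 -> x = 0.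
Proof. by move=> [] /l2norm_eq0. Qed.

HB.instance Definition _ := @Lmodule_isNormed.Build R[i] l2
  (fun x => (l2norm x)%:C) normD normZ norm0_eq0.

Lemma l2_normE (x : l2) : `|x| = (l2norm x)%:C.
Proof. by []. Qed.

End SquareSummable.

Section BoundedOperators.
Variables (R : realType) (V W : normedModType R[i]).

Definition bounded_linear : pred (V -> W) :=
  fun f => `[< linear f /\ continuous f >].

Lemma bounded_linear_submod : submod_closed bounded_linear.
Proof.
split=> [|c f g /asboolP[lf cf] /asboolP[lg cg]]; apply/asboolP; split.
- by move=> a u v; rewrite /= scaler0 addr0.
- exact: cst_continuous.
- move=> a u v; have E x : (c *: f + g) x = c *: f x + g x by [].
  by rewrite !E lf lg !scalerDr !scalerA (mulrC c a) addrACA.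
- by move=> x; apply: cvgD; [apply: cvgZr; exact: cf|exact: cg].
Qed.

HB.instance Definition _ :=
  GRing.isSubmodClosed.Build R[i] (V -> W) bounded_linear bounded_linear_submod.

Record bop := Bop { bopval :> V -> W; _ : bopval \in bounded_linear }.

HB.instance Definition _ := [isSub for bopval].
HB.instance Definition _ := [Choice of bop by <:].
HB.instance Definition _ := [SubChoice_isSubLmodule of bop by <:].

Implicit Types T : bop.

Lemma bop_linear T : linear T.
Proof. by have /asboolP[] := valP T. Qed.

HB.instance Definition _ T := GRing.isLinear.Build R[i] V W *:%R T (bop_linear T).

Lemma bop_continuous T : continuous T.
Proof. by have /asboolP[] := valP T. Qed.

Lemma bopP T1 T2 : (forall x, T1 x = T2 x) -> T1 = T2.
Proof. by move=> H; apply: val_inj; apply/funext. Qed.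

Lemma bounded_linearP (f : V -> W) M : linear f ->
  (forall x, `|f x| <= M%:C * `|x|) -> f \in bounded_linear.
Proof.
move=> lf fM; apply/asboolP; split => //.
pose F : {linear V -> W} := HB.pack f (GRing.isLinear.Build R[i] V W *:%R f lf).
apply: (@bounded_linear_continuous _ _ _ F); apply/linear_boundedP.
near=> r => x; rewrite (le_trans (fM x)) // ler_wpM2r //.
by near: r; apply: nbhs_pinfty_ge; rewrite complex_real.
Unshelve. all: by end_near. Qed.

Definition op_bound T (M : R) := 0 <= M /\ forall x, `|T x| <= M%:C * `|x|.

Definition opnorm T : R := inf [set M | op_bound T M].

Lemma op_bound_has_inf T : has_inf [set M | op_bound T M].
Proof.
split; last by exists 0 => M [].
have /linear_bounded_continuous/linear_boundedP /pinfty_ex_gt0[r r0 H] :=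
  @bop_continuous T.
exists (complex.Re r); have rE : (complex.Re r)%:C = r by apply/RRe_real/gtr0_real.
by split => [|x]; [rewrite -ler0c rE ltW | rewrite rE; exact: H].
Qed.

Lemma opnorm_ge0 T : 0 <= opnorm T.
Proof. by apply: lb_le_inf; [case: (op_bound_has_inf T) | move=> M []]. Qed.

Lemma opnorm_le T M : 0 <= M -> (forall x, `|T x| <= M%:C * `|x|) -> opnorm T <= M.
Proof. by move=> M0 TM; apply: ge_inf; [case: (op_bound_has_inf T)|split]. Qed.

Lemma opnormP T x : `|T x| <= (opnorm T)%:C * `|x|.
Proof.
have [->|x0] := eqVneq x 0; first by rewrite linear0 !normr0 mulr0.
have nx : 0 < `|x| by rewrite normr_gt0.
have Re_n (U : normedModType R[i]) (u : U) : (complex.Re `|u|)%:C = `|u|.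
  by apply/RRe_real/ger0_real.
rewrite -ler_pdivrMr // -[X in X <= _]RRe_real ?ger0_real ?divr_ge0 // lecR.
apply: lb_le_inf; first by case: (op_bound_has_inf T).
move=> M [M0 TM]; rewrite -lecR RRe_real ?ger0_real ?divr_ge0 //.
by rewrite ler_pdivrMr.
Qed.

Let normD (S T : bop) : (opnorm (S + T))%:C <= (opnorm S)%:C + (opnorm T)%:C.
Proof.
rewrite -rmorphD lecR; apply: opnorm_le => [|x].
  by rewrite addr_ge0 ?opnorm_ge0.
rewrite rmorphD mulrDl /=.
by rewrite (le_trans (ler_normD _ _)) // lerD ?opnormP.
Qed.

Let normZ_le (c : R[i]) T : opnorm (c *: T) <= complex.Re `|c| * opnorm T.
Proof.
apply: opnorm_le => [|x]; first by rewrite mulr_ge0 ?opnorm_ge0 // -ler0c RRe_real ?ger0_real.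
have cE : (complex.Re `|c|)%:C = `|c| by rewrite RRe_real ?ger0_real.
rewrite rmorphM [X in X * _ * _]cE -mulrA.
by rewrite [X in X <= _]normrZ ler_wpM2l ?opnormP.
Qed.

Let normZ (c : R[i]) T : (opnorm (c *: T))%:C = `|c| * (opnorm T)%:C.
Proof.
have cE : `|c| = (complex.Re `|c|)%:C by rewrite RRe_real ?ger0_real.
have [->|c0] := eqVneq c 0.
  rewrite scale0r normr0 mul0r; congr _%:C; apply/eqP; rewrite eq_le opnorm_ge0.
  by rewrite andbT opnorm_le // => x; rewrite normr0 mul0r.
rewrite cE -rmorphM; congr _%:C.
apply/eqP; rewrite eq_le normZ_le /=.
have := normZ_le c^-1 (c *: T); rewrite scalerA mulVf // scale1r => h.
have n0 : 0 <= complex.Re `|c| by rewrite -ler0c RRe_real ?ger0_real.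
rewrite (le_trans (ler_wpM2l n0 h)) // mulrA.
suff -> : complex.Re `|c| * complex.Re `|c^-1| = 1 by rewrite mul1r.
have cE' : `|c^-1| = (complex.Re `|c^-1|)%:C by rewrite RRe_real ?ger0_real.
apply/(@complexI R); rewrite rmorphM.
by rewrite -[X in X * _]cE -[X in _ * X]cE' -normrM divff ?normr1.
Qed.

Let norm0_eq0 T : (opnorm T)%:C = 0 -> T = 0.
Proof.
move=> [T0]; apply: bopP => x; apply/eqP; rewrite -normr_le0.
by rewrite (le_trans (opnormP _ _)) // T0 mul0r.
Qed.

HB.instance Definition _ := @Lmodule_isNormed.Build R[i] bop
  (fun T => (opnorm T)%:C) normD normZ norm0_eq0.

End BoundedOperators.

Section Composition.
Variables (R : realType) (U V W : normedModType R[i]).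

Lemma bcomp_subproof (S : bop V W) (T : bop U V) : (S \o T : U -> W) \in @bounded_linear R U W.
Proof.
apply/asboolP; split=> [c x y|x]; first by rewrite /= !linearP.
by apply: continuous_comp; exact: bop_continuous.
Qed.

Definition bcomp (S : bop V W) (T : bop U V) : bop U W := Bop (bcomp_subproof S T).

Lemma bid_subproof : (idfun : U -> U) \in @bounded_linear R U U.
Proof. by apply/asboolP; split=> // x; exact: cvg_id. Qed.

Definition bid : bop U U := Bop bid_subproof.

End Composition.
Notation endop R I := (bop (l2 R I) (l2 R I)).

Section PureTensors.
Variables (R : realType).
Local Open Scope ereal_scope.

Lemma esumZ_le (I : choiceType) (f : I -> R) (c M : R) : (0 <= c)%R ->
  \esum_(i in [set: I]) (f i)%:E <= M%:E ->
  \esum_(i in [set: I]) (c * f i)%:E <= (c * M)%:E.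
Proof.
move=> c0 fM; apply: ge_ereal_sup => _ [X [fX _] <-].
rewrite fsumEFin// lee_fin -mulr_fsumr ler_wpM2l // -lee_fin.
apply: le_trans fM; apply: esum_ge; exists X => //; by rewrite fsumEFin.
Qed.

Lemma ge_esum1 (I : choiceType) (a : I -> \bar R) i :
  a i <= \esum_(i in [set: I]) a i.
Proof.
apply: esum_ge; exists [set i]; first by split=> //; exact: finite_set1.
by rewrite fsbig_set1.
Qed.

Lemma sqsum_pair (I J : choiceType) (f : I * J -> R[i]) :
  sqsum f = \esum_(i in [set: I]) sqsum (fun j => f (i, j)).
Proof.
rewrite /sqsum esum_esum; last by move=> *; rewrite lee_fin nrm2_ge0.
rewrite (_ : _ `*`` _ = setT); first by apply: eq_esum => -[].
by apply/seteqP; split.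
Qed.

Lemma sqsum_inj (I J : choiceType) (h : J -> I) (f : I -> R[i]) :
  injective h -> sqsum (f \o h) <= sqsum f.
Proof.
move=> hinj; rewrite /sqsum.
rewrite -(@esum_image _ _ _ setT h (fun i => (nrm2 (f i))%:E)); last by move=> x y _ _ /hinj.
by apply: ereal_sup_le => _ [X [fX _] <-]; exists X.
Qed.

End PureTensors.

Section L2Vectors.
Variables (R : realType) (I J : choiceType).

Lemma delta_subproof (i : I) : (fun k => (k == i)%:R : R[i]) \in @sqsummable R I.
Proof.
apply/sqsummableP; exists 1; apply/sqsum_leP => X fX.
have [iX|iX] := boolP (i \in X).
  move: iX; rewrite inE => iX; rewrite (fsbigD1 i) //=.
  rewrite fsbig1 ?addr0; first by rewrite /nrm2 eqxx /= expr1n expr0n addr0.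
  by move=> k [_ /= /eqP/negbTE ->]; rewrite /nrm2 /= expr0n addr0.
rewrite fsbig1 // => k kX; have [ki|ki] := eqVneq k i.
  by move: iX; rewrite -ki notin_setE.
by rewrite /nrm2 /= expr0n addr0.
Qed.

Definition delta (i : I) : l2 R I := L2 (delta_subproof i).

Lemma vtens_subproof (x : l2 R I) (y : l2 R J) :
  (fun p => x p.1 * y p.2) \in @sqsummable R (I * J)%type.
Proof.
apply/sqsummableP; exists (l2norm y ^+ 2 * l2norm x ^+ 2); rewrite sqsum_pair.
apply: le_trans (esumZ_le (sqr_ge0 _) (_ : (sqsum x <= _)%E)); last by rewrite sqsum_l2.
apply: le_esum => i _ /=; rewrite mulrC.
by apply: (@sqsumZ_le R J (x i) y); rewrite sqsum_l2.
Qed.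

Definition vtens (x : l2 R I) (y : l2 R J) : l2 R (I * J)%type :=
  L2 (vtens_subproof x y).

Lemma slice_subproof (x : l2 R (I * J)%type) (i : I) :
  (fun j => x (i, j)) \in @sqsummable R J.
Proof.
apply/sqsummableP; exists (l2norm x ^+ 2); rewrite -sqsum_l2 sqsum_pair.
exact: (ge_esum1 (fun i => sqsum (fun j => x (i, j)))).
Qed.

Definition slice x i : l2 R J := L2 (slice_subproof x i).

Lemma sum_slice x : (\esum_(i in [set: I]) ((l2norm (slice x i))^+2)%:E)%E =
  (l2norm x ^+ 2)%:E.
Proof. by rewrite -sqsum_l2 sqsum_pair; apply: eq_esum => i _; rewrite -sqsum_l2. Qed.

Lemma sliceE x i j : slice x i j = x (i, j). Proof. by []. Qed.

Lemma slice_linear i : linear (slice^~ i).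
Proof. by move=> c x y; apply: l2P. Qed.

End L2Vectors.
Arguments delta {R I} i.

Section Reindex.
Variables (R : realType) (I J : choiceType) (h : J -> I) (h_inj : injective h).

Lemma reindex_subproof (x : l2 R I) : (x \o h) \in @sqsummable R J.
Proof.
apply/sqsummableP; exists (l2norm x ^+ 2); rewrite -sqsum_l2.
exact: sqsum_inj.
Qed.

Definition reindex_l2 (x : l2 R I) : l2 R J := L2 (reindex_subproof x).

Lemma reindex_bounded : reindex_l2 \in @bounded_linear R (l2 R I) (l2 R J).
Proof.
apply: (@bounded_linearP _ _ _ _ 1); first by move=> c x y; apply: l2P.
move=> x; rewrite mul1r lecR; apply/l2norm_leP; first exact: l2norm_ge0.
by rewrite -sqsum_l2 sqsum_inj.
Qed.

Definition reindex_op : bop (l2 R I) (l2 R J) := Bop reindex_bounded.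

End Reindex.

Section Tensor.
Variables (R : realType).

Section Ampliation.
Variables (I J : choiceType) (S : endop R J).

Lemma amp_fun_sqsum (x : l2 R (I * J)%type) :
  (sqsum (fun p => S (slice x p.1) p.2) <= ((opnorm S * l2norm x) ^+ 2)%:E)%E.
Proof.
rewrite sqsum_pair exprMn.
apply: le_trans (@esumZ_le _ _ (fun i => l2norm (slice x i) ^+ 2) _ _
  (sqr_ge0 (opnorm S)) _); last by rewrite sum_slice.
apply: le_esum => i _ /=; rewrite sqsum_l2 lee_fin -exprMn.
rewrite ler_sqr ?nnegrE ?mulr_ge0 ?opnorm_ge0 ?l2norm_ge0 //.
by have := opnormP S (slice x i); rewrite !l2_normE -rmorphM lecR.
Qed.

Lemma amp_fun_subproof (x : l2 R (I * J)%type) :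
  (fun p => S (slice x p.1) p.2) \in @sqsummable R (I * J)%type.
Proof. by apply/sqsummableP; eexists; exact: amp_fun_sqsum. Qed.

(** [amp_fun] is I (x) S: it applies [S] to each slice [j |-> x (i, j)]. *)
Definition amp_fun x : l2 R (I * J)%type := L2 (amp_fun_subproof x).

Lemma amp_bounded : amp_fun \in @bounded_linear R _ _.
Proof.
apply: (@bounded_linearP _ _ _ _ (opnorm S)).
  by move=> c x y; apply: l2P => -[i j]; rewrite /= slice_linear linearP.
move=> x; rewrite l2_normE -rmorphM lecR; apply/l2norm_leP; last exact: amp_fun_sqsum.
by rewrite mulr_ge0 ?opnorm_ge0 ?l2norm_ge0.
Qed.

Definition amp : endop R (I * J)%type := Bop amp_bounded.

Lemma ampE (x : l2 R I) (y : l2 R J) : amp (vtens x y) = vtens x (S y).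
Proof.
apply: l2P => -[i j] /=.
rewrite (_ : slice _ i = x i *: y); first by rewrite linearZ.
by apply: l2P => k.
Qed.

End Ampliation.

Lemma swap_inj (I J : choiceType) : injective (fun p : I * J => (p.2, p.1)).
Proof. by move=> [a b] [c d] [-> ->]. Qed.

Definition tswap (I J : choiceType) : bop (l2 R (J * I)%type) (l2 R (I * J)%type) :=
  reindex_op R (@swap_inj I J).

Lemma tswapE (I J : choiceType) (x : l2 R I) (y : l2 R J) :
  tswap J I (vtens x y) = vtens y x.
Proof. by apply: l2P => -[i j] /=; rewrite mulrC. Qed.

(** l^2(I) (x) l^2(J) is realized as l^2(I * J); see [tensE]. *)
Definition tens (I J : choiceType) (T : endop R I) (S : endop R J) : endop R (I * J)%type :=
  bcomp (bcomp (tswap I J) (bcomp (amp J T) (tswap J I))) (amp I S).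

Lemma tensE (I J : choiceType) (T : endop R I) (S : endop R J) (x : l2 R I) (y : l2 R J) :
  tens T S (vtens x y) = vtens (T x) (S y).
Proof.
have -> : tens T S (vtens x y) =
  tswap I J (amp J T (tswap J I (amp I S (vtens x y)))) by [].
by rewrite ampE tswapE ampE tswapE.
Qed.

End Tensor.

Section InnerProduct.
Variable R : realType.

(** Only meaningful for absolutely summable families. *)
Definition rsum (I : choiceType) (f : I -> R) : R :=
  fine (\esum_(i in [set: I]) (Num.max (f i) 0)%:E)%E -
  fine (\esum_(i in [set: I]) (Num.max (- f i) 0)%:E)%E.

Definition csum (I : choiceType) (f : I -> R[i]) : R[i] :=
  Complex (rsum (fun i => complex.Re (f i))) (rsum (fun i => complex.Im (f i))).

Definition dot (I : choiceType) (x y : l2 R I) : R[i] :=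
  csum (fun i => (x i)^* * y i).

Lemma rsum_set1 (I : choiceType) (f : I -> R) i :
  (forall k, k != i -> f k = 0) -> rsum f = f i.
Proof.
move=> f0.
have E (h : I -> R) : (forall k, 0 <= h k) -> (forall k, k != i -> h k = 0) ->
    fine (\esum_(k in [set: I]) (h k)%:E)%E = h i.
  move=> hp h0; rewrite (_ : (\esum_(k in _) _)%E = (h i)%:E) //.
  rewrite (esumID [set i]) => [|k _]; last by rewrite lee_fin.
  rewrite setTI esum_set1 ?lee_fin // setTI esum1 ?adde0 // => k /eqP ki.
  by rewrite h0.
rewrite /rsum !E.
- have [h|/ltW h] := leP (f i) 0.
    by rewrite max_l ?oppr_ge0 // sub0r opprK.
  by rewrite max_r ?oppr_le0 // subr0.
- by move=> k; rewrite le_max lexx orbT.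
- by move=> k /f0 ->; rewrite oppr0 maxxx.
- by move=> k; rewrite le_max lexx orbT.
- by move=> k /f0 ->; rewrite maxxx.
Qed.

Lemma dot_delta (I : choiceType) (i : I) (x : l2 R I) : dot (delta i) x = x i.
Proof.
rewrite /dot /csum !(rsum_set1 (i := i)) /=.
- by rewrite eqxx; case: (x i) => a b /=; rewrite oppr0 !mul0r !mul1r subr0 addr0.
- by move=> k /negbTE ->; case: (x k) => a b /=; rewrite oppr0 !mul0r addr0.
- by move=> k /negbTE ->; case: (x k) => a b /=; rewrite oppr0 !mul0r subr0.
Qed.

Lemma dot_norm (I : choiceType) (x : l2 R I) : dot x x = `|x| ^+ 2.
Proof.
rewrite l2_normE -rmorphXn /dot /csum.
have -> : rsum (fun i => complex.Im ((x i)^* * x i)) = 0.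
  have E i : complex.Im ((x i)^* * x i) = 0 by case: (x i) => a b /=; ring.
  by rewrite /rsum !esum1 ?subrr // => i _; rewrite E ?oppr0 maxxx.
have E i : complex.Re ((x i)^* * x i) = nrm2 (x i).
  by case: (x i) => a b; rewrite /nrm2 /=; ring.
have E1 : (\esum_(i in [set: I]) (Num.max (complex.Re ((x i)^* * x i)) 0)%:E)%E
    = (l2norm x ^+ 2)%:E.
  by rewrite -sqsum_l2; apply: eq_esum => i _; rewrite E max_l // nrm2_ge0.
have E2 : (\esum_(i in [set: I]) (Num.max (- complex.Re ((x i)^* * x i)) 0)%:E)%E
    = 0%E.
  by rewrite esum1 // => i _; rewrite E max_r // oppr_le0 nrm2_ge0.
by rewrite /rsum E1 E2 /= subr0.
Qed.

End InnerProduct.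

Section UnilateralShift.
Variable R : realType.

Lemma ushift_sqsum (x : nat -> R[i]) :
  sqsum (fun k => if k is k'.+1 then x k' else 0) = sqsum x.
Proof.
rewrite /sqsum (esumID [set 0%N]); last by move=> k _; rewrite lee_fin nrm2_ge0.
rewrite setTI esum_set1 ?lee_fin ?nrm2_ge0 // setTI.
rewrite (_ : ~` [set 0%N] = succn @` [set: nat]).
  rewrite esum_image; last by move=> a b _ _ [].
  by rewrite /nrm2 /= expr0n addr0 add0e.
by apply/seteqP; split=> [[|k] //= _|_ [k _ <-] //]; exists k.
Qed.

Lemma ushift_subproof (x : l2 R nat) :
  (fun k => if k is k'.+1 then x k' else 0) \in @sqsummable R nat.
Proof. by rewrite unfold_in /sqsummable ushift_sqsum; exact: (valP x). Qed.

Definition ushift_fun (x : l2 R nat) : l2 R nat := L2 (ushift_subproof x).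

Lemma ushift_bounded : ushift_fun \in @bounded_linear R (l2 R nat) (l2 R nat).
Proof.
apply: (@bounded_linearP _ _ _ _ 1).
  move=> c x y; apply: l2P => -[|k] //=; apply: esym.
  by transitivity (c * 0 + 0) => //; rewrite mulr0 addr0.
move=> x; rewrite mul1r lecR; apply/l2norm_leP; first exact: l2norm_ge0.
by rewrite -sqsum_l2 /= ushift_sqsum.
Qed.

Definition ushift : bop (l2 R nat) (l2 R nat) := Bop ushift_bounded.

Lemma ushiftE k : ushift (delta k) = delta k.+1.
Proof. by apply: l2P => -[|j]. Qed.

End UnilateralShift.

Section OperatorAlgebras.
Variable R : realType.

Definition adjoint_op (I J : choiceType) (T : bop (l2 R I) (l2 R J))
    (S : bop (l2 R J) (l2 R I)) : Prop :=
  forall x y, dot (T x) y = dot x (S y).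

Definition unitary_op (I J : choiceType) (U : bop (l2 R I) (l2 R J))
    (Us : bop (l2 R J) (l2 R I)) : Prop :=
  [/\ adjoint_op U Us, bcomp Us U = bid _ & bcomp U Us = bid _].

Definition compact_op (I : choiceType) : set (endop R I) :=
  [set T | precompact (T @` [set x | `|x| <= 1])].

Definition op_cstar_subalgebra (I : choiceType) : set (set (endop R I)) :=
  [set D | [/\ D 0,
    forall (c : R[i]) S T, D S -> D T -> D (c *: S + T),
    forall S T, D S -> D T -> D (bcomp S T),
    forall S T, adjoint_op S T -> D S -> D T &
    closed D]].

Definition toeplitz : set (endop R nat) :=
  smallest (@op_cstar_subalgebra nat) [set ushift R].

(** No scalars are needed in the sums: this is meant for linear subspaces [B]
    and [D]. *)
Definition spatial_tensor (I J : choiceType) (B : set (endop R I))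
    (D : set (endop R J)) : set (endop R (I * J)%type) :=
  closure [set X | exists n (b : 'I_n -> endop R I) (d : 'I_n -> endop R J),
    [/\ forall k, B (b k), forall k, D (d k) & X = \sum_(k < n) tens (b k) (d k)]].

(** For a C*-algebra acting nondegenerately, M(E) is its idealizer. *)
Definition multiplier (I : choiceType) (E : set (endop R I)) : set (endop R I) :=
  [set X | forall e, E e -> E (bcomp X e) /\ E (bcomp e X)].

End OperatorAlgebras.

(** The multiplication is part of this mixin, not inherited from
    [GRing.Algebra]: Hierarchy Builder refuses a join of the ring and the
    normed-module hierarchies made downstream of [Num.NumDomain]. *)
HB.mixin Record isCstar (R : realType) A of CompleteNormedModule R[i] A := {
  cmul : A -> A -> A;
  cone : A;
  star : A -> A;
  cmulA : associative cmul;
  cmul1a : left_id cone cmul;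
  cmula1 : right_id cone cmul;
  cmulDl : left_distributive cmul +%R;
  cmulDr : right_distributive cmul +%R;
  cmulZl : forall (c : R[i]) (a b : A), cmul (c *: a) b = c *: cmul a b;
  cmulZr : forall (c : R[i]) (a b : A), cmul a (c *: b) = c *: cmul a b;
  starK : involutive star;
  starD : {morph star : a b / a + b};
  starZ : forall (c : R[i]) (a : A), star (c *: a) = c^* *: star a;
  starM : forall a b : A, star (cmul a b) = cmul (star b) (star a);
  cstar_normM : forall a b : A, `|cmul a b| <= `|a| * `|b|;
  cstar_identity : forall a : A, `|cmul (star a) a| = `|a| ^+ 2
}.

#[short(type="cstarType")]
HB.structure Definition Cstar (R : realType) :=
  {A of isCstar R A & CompleteNormedModule R[i] A}.

Notation "a ** b" := (cmul a b) (at level 40, left associativity).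

Section StarMorphisms.
Variable R : realType.

Definition unital_star_hom (A B : cstarType R) (f : A -> B) : Prop :=
  [/\ linear f, {morph f : a b / a ** b}, f cone = cone &
      forall a, f (star a) = star (f a)].

Definition star_rep (A : cstarType R) (I : choiceType) (f : A -> endop R I) : Prop :=
  [/\ linear f, forall a b, f (a ** b) = bcomp (f a) (f b) &
      forall a, adjoint_op (f a) (f (star a))].

Definition unital_star_rep (A : cstarType R) (I : choiceType)
    (f : A -> endop R I) : Prop := star_rep f /\ f cone = bid _.

Definition cstar_subalgebra (A : cstarType R) : set (set A) :=
  [set D | [/\ D 0,
    forall (c : R[i]) a b, D a -> D b -> D (c *: a + b),
    forall a b, D a -> D b -> D (a ** b),
    forall a, D a -> D (star a) &
    closed D]].

End StarMorphisms.

(** [B] is a C*-algebra acting nondegenerately on l^2(I), and the stabilizing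
    Hilbert space is l^2(J). *)
Section KK.
Variables (R : realType) (A : cstarType R) (I J : choiceType).
Variable B : set (endop R I).

Let BK := spatial_tensor B (@compact_op R J).

Definition quasihom (p : (A -> endop R (I * J)%type) * (A -> endop R (I * J)%type))
    : Prop :=
  [/\ star_rep p.1, star_rep p.2,
      forall a, multiplier BK (p.1 a),
      forall a, multiplier BK (p.2 a) &
      forall a, BK (p.1 a - p.2 a)].

Definition strictly_continuous (X : R -> endop R (I * J)%type) : Prop :=
  forall e, BK e ->
    {within `[0, 1], continuous (fun t => bcomp (X t) e)} /\
    {within `[0, 1], continuous (fun t => bcomp e (X t))}.

(** A quasihomomorphism from A to C([0,1], B), written as a path: pointwise
    strictly continuous, with norm-continuous difference. *)
Definition quasihom_homotopic
    (p0 p1 : (A -> endop R (I * J)%type) * (A -> endop R (I * J)%type)) : Prop :=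
  exists P : R -> (A -> endop R (I * J)%type) * (A -> endop R (I * J)%type),
    [/\ forall t, t \in `[0, 1] -> quasihom (P t),
        forall a, strictly_continuous (fun t => (P t).1 a) /\
                  strictly_continuous (fun t => (P t).2 a),
        forall a, {within `[0, 1], continuous (fun t => (P t).1 a - (P t).2 a)},
        P 0 = p0 & P 1 = p1].

Definition KK_class p := [set p' | quasihom p' /\ quasihom_homotopic p p'].

(** The underlying set of the group KK(A, B): homotopy classes of
    quasihomomorphisms. *)
Definition KK := [set c | exists2 p, quasihom p & c = KK_class p].

End KK.

Section SUq2.
Variables (R : realType) (q : R).

Definition SUq2_relations (A : cstarType R) (alpha beta : A) : Prop :=
  [/\ star alpha ** alpha + star beta ** beta = cone,
      alpha ** star alpha + (q ^+ 2)%:C *: (beta ** star beta) = cone,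
      alpha ** beta = q%:C *: (beta ** alpha),
      alpha ** star beta = q%:C *: (star beta ** alpha) &
      star beta ** beta = beta ** star beta].

Definition is_C_SUq2 (A : cstarType R) (alpha beta : A) : Prop :=
  [/\ SUq2_relations alpha beta,
      smallest (@cstar_subalgebra R A) [set alpha; beta] = [set: A] &
      forall (B : cstarType R) (a b : B), SUq2_relations a b ->
        exists! f : A -> B, [/\ unital_star_hom f, f alpha = a & f beta = b]].

(** [reindex_op h x = x \o h], so both operators map e_k to e_{k-1} (and e_0 to 0
    on l^2(N)). *)
Definition lshiftN : endop R nat := reindex_op R succn_inj.

Definition lshiftZ : endop R int := reindex_op R (@addrI int 1).

Lemma lshiftNE k : lshiftN (delta k) = if k is k'.+1 then delta k' else 0.
Proof. by apply: l2P => j; case: k => [|k]. Qed.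

Lemma lshiftZE l : lshiftZ (delta l) = delta (l - 1).
Proof. by apply: l2P => j; rewrite /= (can2_eq (addKr 1) (addNKr 1)) addrC. Qed.

Definition is_pi_q (A : cstarType R) (alpha beta : A)
    (pi : A -> endop R (nat * int)%type) : Prop :=
  [/\ unital_star_rep pi,
      forall k l, pi alpha (vtens (delta k) (delta l)) =
        (Num.sqrt (1 - q ^+ (2 * k)))%:C *: vtens (lshiftN (delta k)) (delta l) &
      forall k l, pi beta (vtens (delta k) (delta l)) =
        (q ^+ k)%:C *: vtens (delta k) (lshiftZ (delta l))].

Definition in_Gamma : pred (rat * rat * rat) := fun '(n, i, j) =>
  [&& 2 * n \is a Num.nat, n + i \is a Num.nat, n - i \is a Num.nat,
      n + j \is a Num.nat & n - j \is a Num.nat].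

Definition Gamma := {p : rat * rat * rat | in_Gamma p}.

(** e^n_{ij}, read as 0 when (n, i, j) is not in Gamma. *)
Definition eG (n i j : rat) : l2 R Gamma :=
  if insub (n, i, j) is Some p then delta p else 0.

(** Only used at integral [r]. *)
Definition qpow (r : rat) : R := q ^ Num.floor r.

Definition gq (k : rat) : R := Num.sqrt (1 - qpow (2 * k)).

Definition a_plus (n i j : rat) : R :=
  qpow (2 * n + i + j + 1) * (gq (n - j + 1) * gq (n - i + 1))
  / (gq (2 * n + 1) * gq (2 * n + 2)).

Definition a_minus (n i j : rat) : R :=
  if n == 0 then 0 else
  (gq (n + j) * gq (n + i)) / (gq (2 * n) * gq (2 * n + 1)).

Definition b_plus (n i j : rat) : R :=
  - qpow (n + j) * (gq (n - j + 1) * gq (n + i + 1))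
  / (gq (2 * n + 1) * gq (2 * n + 2)).

Definition b_minus (n i j : rat) : R :=
  if n == 0 then 0 else
  qpow (n + i) * (gq (n + j) * gq (n - i)) / (gq (2 * n) * gq (2 * n + 1)).

(** L^2(SU_q(2)) is identified with l^2(Gamma) through the orthonormal basis of
    normalized matrix entries; the GNS representation of the Haar state is the
    one given on this basis by these formulas. *)
Definition is_lambda_q (A : cstarType R) (alpha beta : A)
    (lambda : A -> endop R Gamma) : Prop :=
  [/\ unital_star_rep lambda,
      forall n i j, in_Gamma (n, i, j) -> lambda alpha (eG n i j) =
        (a_plus n i j)%:C *: eG (n + 1/2) (i - 1/2) (j - 1/2) +
        (a_minus n i j)%:C *: eG (n - 1/2) (i - 1/2) (j - 1/2) &
      forall n i j, in_Gamma (n, i, j) -> lambda beta (eG n i j) =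
        (b_plus n i j)%:C *: eG (n + 1/2) (i + 1/2) (j - 1/2) +
        (b_minus n i j)%:C *: eG (n - 1/2) (i + 1/2) (j - 1/2)].

End SUq2.

(* Main.v *)
Require Import Defs.
From HB Require Import structures.
From mathcomp Require Import all_boot all_order all_algebra.
From mathcomp Require Import complex finmap ring lra zify.
From mathcomp Require Import all_classical all_reals all_analysis.
Import Order.TTheory GRing.Theory Num.Theory.
Import numFieldNormedType.Exports.
Local Open Scope classical_set_scope.
Local Open Scope ring_scope.
Set Implicit Arguments. Unset Strict Implicit. Unset Printing Implicit Defensive.

(** Put m = min(n-i, n-j), k = min(n+i, n+j) and l = j-i.  This is a bijection
    from Gamma to N x N x Z, and U sends e^n_ij to (-1)^max(-l,0) e_m (x) e_k (x) e_l.
    In these coordinates U lambda(a) U^* - I (x) pi(a), for a = alpha or beta, is a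
    finite sum of operators (S (x) T) D, where S is I, the unilateral shift or its
    adjoint, T is bounded, and D is diagonal with weights w(m, k, l) which converge
    as m -> oo and are O(|q|^(k + |l|)) uniformly in m; hence D is a norm limit of
    sums of (convergent diagonal) (x) (rank-one projection), which lie in the Toeplitz
    algebra tensor the compacts.  The a for which the difference of both a and a^* is
    in this ideal form a C*-subalgebra, closed because unital *-representations are
    contractive: 1 - a^* a = y^2 with y self-adjoint when |a| < 1. *)

(** The coordinates make the dominant terms of [lambda] fix m. The a_- term of alpha lowers n+i and
    n+j together, hence k alone. The dominant term of beta, b_+ for l <= 0 and b_- for l > 0, only
    moves l to l-1. These terms have the shape of I (x) pi, up to the minus sign of b_+ which U
    absorbs; the other terms carry a factor q^(2k+|l|+1) or q^(k+|l|). The difference is not compact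
    on the whole space: for k > 0 its alpha weight on k -> k-1 tends, as m -> oo, to [gn] k ([gn]
    (k+|l|) - 1), which is not 0 as 0 < |q| < 1. Decay holds only in (k, l). In m there is mere
    convergence, and a convergent diagonal is a scalar plus a diagonal tending to 0: this is why the
    Toeplitz algebra appears instead of the compacts. Since [lambda] and [rho] are given by formulas
    on generators only, membership of the difference in the ideal has to be propagated: products
    need I (x) pi to multiply the ideal into itself, and limits need a Lipschitz bound. *)

Section Rsum.
Context {R : realType} {I : choiceType}.
Implicit Types f g a b : I -> R.

(** [rsum] subtracts two values of [fine], and [fine] sends +oo to 0; absolute summability keeps
    both sums finite, which is what makes [rsum] linear. *)
Definition abs_summable f := (\esum_(i in [set: I]) `|f i|%:E < +oo)%E.

Lemma abs_summable_le f g M : (\esum_(i in [set: I]) (g i)%:E <= M%:E)%E ->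
  (forall i, `|f i| <= g i) -> abs_summable f.
Proof.
move=> gM fg; apply: (@le_lt_trans _ _ M%:E); last by rewrite ltry.
by apply: le_trans gM; apply: le_esum => i _; rewrite lee_fin.
Qed.

Lemma ge0_esum_fin a : (forall i, 0 <= a i) -> abs_summable a ->
  (\esum_(i in [set: I]) (a i)%:E)%E =
  (fine (\esum_(i in [set: I]) (a i)%:E)%E)%:E.
Proof.
move=> a0 sa; rewrite fineK // ge0_fin_numE; last first.
  by apply: esum_ge0 => i _; rewrite lee_fin.
by move: sa; rewrite /abs_summable; under eq_esum do rewrite (ger0_norm (a0 _)).
Qed.

Lemma esum_fineD a b : (forall i, 0 <= a i) -> (forall i, 0 <= b i) ->
  abs_summable a -> abs_summable b ->
  fine (\esum_(i in [set: I]) (a i + b i)%:E)%E =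
  fine (\esum_(i in [set: I]) (a i)%:E)%E +
  fine (\esum_(i in [set: I]) (b i)%:E)%E.
Proof.
move=> a0 b0 sa sb; under eq_esum do rewrite EFinD.
rewrite esumD; try by move=> *; rewrite lee_fin.
by rewrite (ge0_esum_fin _ sa) // (ge0_esum_fin _ sb).
Qed.

Lemma abs_summableD f g : abs_summable f -> abs_summable g ->
  abs_summable (fun i => f i + g i).
Proof.
move=> sf sg; apply: (@le_lt_trans _ _ (\esum_(i in [set: I]) `|f i|%:E +
   \esum_(i in [set: I]) `|g i|%:E)%E); last exact: lte_add_pinfty.
rewrite -esumD; try by move=> *; rewrite lee_fin.
by apply: le_esum => i _; rewrite lee_fin ler_normD.
Qed.

Lemma abs_summable_max f : abs_summable f ->
  abs_summable (fun i => Num.max (f i) 0).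
Proof.
apply: le_lt_trans; apply: le_esum => i _; rewrite lee_fin.
by case: (leP (f i) 0) => // _; rewrite normr0.
Qed.

Lemma abs_summableZ c f : abs_summable f -> abs_summable (fun i => c * f i).
Proof.
move=> sf.
apply: (@abs_summable_le _ (fun i => `|c| * `|f i|)
  (`|c| * fine (\esum_(i in [set: I]) `|f i|%:E)%E)); last first.
  by move=> i; rewrite normrM.
apply: esumZ_le => //; rewrite -ge0_esum_fin // /abs_summable.
by under eq_esum do rewrite normr_id.
Qed.

Lemma abs_summableN f : abs_summable f -> abs_summable (fun i => - f i).
Proof. by rewrite /abs_summable; under eq_esum do rewrite -normrN. Qed.

(** The positive and negative parts may be replaced by any nonnegative summable decomposition,
    because (a - b)^+ + b = (a - b)^- + a termwise and nonnegative sums are additive. For f + g the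
    decomposition used is the one by the parts of f and of g. *)
Lemma rsumB a b : (forall i, 0 <= a i) -> (forall i, 0 <= b i) ->
  abs_summable a -> abs_summable b ->
  rsum (fun i => a i - b i) =
  fine (\esum_(i in [set: I]) (a i)%:E)%E -
  fine (\esum_(i in [set: I]) (b i)%:E)%E.
Proof.
move=> a0 b0 sa sb; rewrite /rsum.
have sab : abs_summable (fun i => a i - b i).
  by apply: abs_summableD => //; exact: abs_summableN.
have m0 (x : R) : 0 <= Num.max x 0 by rewrite le_max lexx orbT.
apply/eqP; rewrite subr_eq addrAC eq_sym subr_eq; apply/eqP.
have sN : abs_summable (fun i => Num.max (- (a i - b i)) 0).
  by apply: (abs_summable_max (f := fun i => - (a i - b i))); exact: abs_summableN.
rewrite -!esum_fineD //; try exact: abs_summable_max.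
by congr fine; apply: eq_esum => i _; congr EFin; rewrite /Num.max; do !case: ifP; lra.
Qed.

Lemma rsumD f g : abs_summable f -> abs_summable g ->
  rsum (fun i => f i + g i) = rsum f + rsum g.
Proof.
move=> sf sg.
have m0 (x : R) : 0 <= Num.max x 0 by rewrite le_max lexx orbT.
have E (h : I -> R) i : h i = Num.max (h i) 0 - Num.max (- h i) 0.
  by rewrite /Num.max; do !case: ifP; lra.
have -> : (fun i => f i + g i) =
  (fun i => (Num.max (f i) 0 + Num.max (g i) 0) -
            (Num.max (- f i) 0 + Num.max (- g i) 0)).
  by apply/funext => i; rewrite {1}(E f) {1}(E g); ring.
have sN (h : I -> R) : abs_summable h -> abs_summable (fun i => Num.max (- h i) 0).
  by move=> sh; apply: (abs_summable_max (f := fun i => - h i)); exact: abs_summableN.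
have sP := @abs_summable_max.
rewrite rsumB; first last.
- by apply: abs_summableD; exact: sN.
- by apply: abs_summableD; exact: sP.
- by move=> i; rewrite addr_ge0.
- by move=> i; rewrite addr_ge0.
rewrite (esum_fineD (fun i => m0 (f i)) (fun i => m0 (g i)) (sP _ sf) (sP _ sg)).
rewrite (esum_fineD (fun i => m0 (- f i)) (fun i => m0 (- g i)) (sN _ sf) (sN _ sg)).
by rewrite /rsum; ring.
Qed.

Lemma rsumN f : rsum (fun i => - f i) = - rsum f.
Proof.
rewrite /rsum opprB; congr (fine _ - _).
by congr fine; apply: eq_esum => i _; rewrite opprK.
Qed.

Lemma rsumZ c f : abs_summable f -> rsum (fun i => c * f i) = c * rsum f.
Proof.
have [-> sf|c0] := eqVneq c 0.
  by rewrite mul0r /rsum !esum1 ?subrr // => i _; rewrite mul0r ?oppr0 maxxx.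
wlog c_gt0 : c c0 / 0 < c => [W sf|].
  have [|c_gt0] := leP c 0; last exact: W.
  rewrite le_eqVlt (negPf c0) /= => c_lt0.
  rewrite -[c]opprK mulNr -W ?oppr_eq0 ?oppr_gt0 // -rsumN; congr rsum.
  by apply/funext => i; rewrite !mulNr opprK.
move=> sf.
have sN : abs_summable (fun i => Num.max (- f i) 0).
  by apply: (abs_summable_max (f := fun i => - f i)); exact: abs_summableN.
have fineZ (h : I -> R) : (forall i, 0 <= h i) -> abs_summable h ->
    fine (\esum_(i in [set: I]) (c * h i)%:E)%E =
    c * fine (\esum_(i in [set: I]) (h i)%:E)%E.
  move=> h0 sh; apply/eqP; rewrite eq_le; apply/andP; split.
    rewrite -lee_fin -ge0_esum_fin; first last.
    - exact: abs_summableZ.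
    - by move=> i; rewrite mulr_ge0 // ltW.
    by apply: esumZ_le; [exact: ltW|rewrite -ge0_esum_fin].
  (* The converse inequality is [esumZ_le] again, with the factor c^-1 and the family c * h. *)
  rewrite -ler_pdivlMl // -lee_fin -ge0_esum_fin //.
  rewrite [X in (X <= _)%E](_ : _ = \esum_(i in [set: I]) (c^-1 * (c * h i))%:E)%E.
    apply: esumZ_le; first by rewrite invr_ge0 ltW.
    rewrite -ge0_esum_fin //; last exact: abs_summableZ.
    by move=> i; rewrite mulr_ge0 // ltW.
  by apply: eq_esum => i _; rewrite mulKf.
rewrite /rsum mulrBr -!fineZ //; last exact: abs_summable_max.
  by congr (fine _ - fine _); apply: eq_esum => i _;
    rewrite ?maxr_pMr ?mulr0 ?mulrN // ltW.
all: by move=> i; rewrite le_max lexx orbT.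
Qed.

End Rsum.

(** * Sesquilinearity of the inner product and the Cauchy-Schwarz inequality *)

Section Dot.
Context {R : realType} {I : choiceType}.
Implicit Types x y z : l2 R I.

Let sre x y : abs_summable (fun i => complex.Re ((x i)^* * y i)).
Proof.
apply: (@abs_summable_le _ _ _ (fun i => nrm2 (x i) + nrm2 (y i))
   (l2norm x ^+ 2 + l2norm y ^+ 2)).
  under eq_esum do rewrite EFinD.
  rewrite esumD; try by move=> *; rewrite lee_fin nrm2_ge0.
  by rewrite EFinD -!sqsum_l2.
move=> i; case: (x i) (y i) => a b [c d]; rewrite /nrm2 /= ler_norml.
have [[[? ?] ?] ?] := (sqr_ge0 (a + c), sqr_ge0 (a - c), sqr_ge0 (b + d), sqr_ge0 (b - d)).
by apply/andP; split; nra.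
Qed.

Let sim x y : abs_summable (fun i => complex.Im ((x i)^* * y i)).
Proof.
apply: (@abs_summable_le _ _ _ (fun i => nrm2 (x i) + nrm2 (y i))
   (l2norm x ^+ 2 + l2norm y ^+ 2)).
  under eq_esum do rewrite EFinD.
  rewrite esumD; try by move=> *; rewrite lee_fin nrm2_ge0.
  by rewrite EFinD -!sqsum_l2.
move=> i; case: (x i) (y i) => a b [c d]; rewrite /nrm2 /= ler_norml.
have [[[? ?] ?] ?] := (sqr_ge0 (a + d), sqr_ge0 (a - d), sqr_ge0 (b + c), sqr_ge0 (b - c)).
by apply/andP; split; nra.
Qed.

Lemma dotDr x y z : dot x (y + z) = dot x y + dot x z.
Proof.
rewrite /dot (_ : (fun i => (x i)^*%C * (y + z) i) =
  (fun i => (x i)^*%C * (y i + z i))) //.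
rewrite /csum; apply/eqP; rewrite eq_complex /= -!rsumD //.
by apply/andP; split; apply/eqP; congr rsum; apply/funext => i /=;
   case: (x i) (y i) (z i) => a b [c d] [e f] /=; ring.
Qed.

Lemma dotZr (c : R[i]) x y : dot x (c *: y) = c * dot x y.
Proof.
rewrite /dot (_ : (fun i => (x i)^*%C * (c *: y) i) =
  (fun i => (x i)^*%C * (c * y i))) //.
case: c => c d; rewrite /csum; apply/eqP; rewrite eq_complex /= -!rsumZ //.
have H (a : R) := abs_summableZ a (sre x y); have H' (a : R) := abs_summableZ a (sim x y).
rewrite -rsumN -(rsumD (H _) (abs_summableN (H' _))) -(rsumD (H' _) (H _)).
by apply/andP; split; apply/eqP; congr rsum; apply/funext => i /=;
   case: (x i) (y i) => a b [e f] /=; ring.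
Qed.

Lemma dotC x y : dot y x = (dot x y)^*%C.
Proof.
rewrite /dot /csum; apply/eqP; rewrite eq_complex /= -rsumN.
by apply/andP; split; apply/eqP; congr rsum; apply/funext => i /=;
   case: (x i) (y i) => a b [e f] /=; ring.
Qed.

Lemma dotDl x y z : dot (x + y) z = dot x z + dot y z.
Proof. by rewrite dotC dotDr rmorphD; congr (_ + _); rewrite [RHS]dotC. Qed.

Lemma dotZl (c : R[i]) x y : dot (c *: x) y = (c^*)%C * dot x y.
Proof. by rewrite dotC dotZr rmorphM; congr (_ * _); rewrite [RHS]dotC. Qed.

Lemma dotBr x y z : dot x (y - z) = dot x y - dot x z.
Proof. by rewrite dotDr -scaleN1r dotZr mulN1r. Qed.

Lemma dotBl x y z : dot (x - y) z = dot x z - dot y z.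
Proof. by rewrite dotDl -scaleN1r dotZl rmorphN rmorph1 mulN1r. Qed.

Lemma dot_deltar x i : dot x (delta i) = ((x i)^*)%C.
Proof. by rewrite dotC dot_delta. Qed.

Lemma dot_l2norm x : dot x x = (l2norm x ^+ 2)%:C%C.
Proof. by rewrite dot_norm l2_normE rmorphXn. Qed.

Lemma cauchy_schwarz x y : `|dot x y| <= `|x| * `|y|.
Proof.
have [->|y0] := eqVneq y 0.
  by rewrite normr0 mulr0 -(scale0r 0) dotZr mul0r normr0.
have ny : 0 < `|y| ^+ 2 by rewrite exprn_gt0 // normr_gt0.
rewrite -(@ler_pXn2r _ 2) ?nnegrE ?mulr_ge0 // exprMn.
rewrite -subr_ge0 -(pmulr_rge0 _ ny).
(* The vector on the right is |y|^2 times the component of x orthogonal to y, which avoids a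
   division. *)
suff -> : `|y| ^+ 2 * (`|x| ^+ 2 * `|y| ^+ 2 - `|dot x y| ^+ 2) =
  dot (`|y| ^+ 2 *: x - ((dot x y)^*)%C *: y) (`|y| ^+ 2 *: x - ((dot x y)^*)%C *: y).
  by rewrite dot_norm exprn_ge0.
have yE : ((`|y| ^+ 2)^*)%C = `|y| ^+ 2 by rewrite l2_normE -rmorphXn; exact: conjc_real.
rewrite sqr_normc !(dotBl, dotBr, dotZl, dotZr) !dot_norm yE conjcK (dotC x y).
set c := dot x y; set d := (c^*)%C; ring.
Qed.

End Dot.

(** * Finitely supported approximation in l^2 *)

Section Approximation.
Context {R : realType} {I : choiceType}.
Implicit Types x y : l2 R I.

Lemma l2DE x y i : (x + y) i = x i + y i. Proof. by []. Qed.
Lemma l2BE x y i : (x - y) i = x i - y i. Proof. by []. Qed.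
Lemma l2ZE (c : R[i]) x i : (c *: x) i = c * x i. Proof. by []. Qed.
Lemma l20E i : (0 : l2 R I) i = 0. Proof. by []. Qed.

Lemma l2_sumE (T : Type) (s : seq T) (f : T -> l2 R I) i :
  (\sum_(t <- s) f t) i = \sum_(t <- s) f t i.
Proof. by elim/big_ind2: _ => // a b c d; rewrite l2DE => -> ->. Qed.

Lemma l2norm_le_sqsum x M : 0 <= M ->
  (sqsum x <= (M ^+ 2)%:E)%E -> l2norm x <= M.
Proof. by move=> M0 /(l2norm_leP _ M0). Qed.

Lemma deltaE (i j : I) : (delta i : l2 R I) j = (j == i)%:R.
Proof. by []. Qed.

Lemma l2_approx x (e : R) : 0 < e -> exists s : seq I,
  l2norm (x - \sum_(i <- s) x i *: delta i) <= e.
Proof.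
move=> e0; have e20 : 0 < e ^+ 2 by rewrite exprn_gt0.
have sfin : sqsum x \is a fin_num by rewrite sqsum_l2.
(* [sqsum x] is a supremum over finite sets: F comes within e^2 of it, so the tail of x off F has
   squared norm below e^2. *)
have [_ [F [finF _] <-] Fx] := ub_ereal_sup_adherent e20 sfin.
exists (fset_set F); apply: l2norm_le_sqsum; first exact: ltW.
set z := x - _.
have zE i : z i = if i \in F then 0 else x i.
  rewrite /z l2BE l2_sumE.
  rewrite (eq_bigr (fun j => if j == i then x i else 0)); last first.
    move=> j _; rewrite l2ZE deltaE eq_sym; case: eqP => [->|_].
      by rewrite mulr1.
    by rewrite mulr0.
  rewrite -big_mkcond; case: ifPn => iF.
    rewrite (big_rem i) ?in_fset_set //= eqxx big_seq_cond big1 ?addr0 ?subrr // => j.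
    by rewrite mem_rem_uniq ?fset_uniq // inE => /andP[/andP[/negbTE ->]].
  rewrite big_seq_cond big1 ?subr0 // => j /andP[+ /eqP ji].
  by rewrite in_fset_set // ji (negbTE iF).
have : (sqsum x = \sum_(i \in F) (nrm2 (x i))%:E + sqsum z)%E.
  rewrite /sqsum (esumID F) => [|i _]; last by rewrite lee_fin nrm2_ge0.
  rewrite setTI esum_fset // => [|i _]; last by rewrite lee_fin nrm2_ge0.
  rewrite setTI; congr (_ + _)%E.
  rewrite (esum_mkcond (~` F)); apply: eq_esum => i _; rewrite zE in_setC.
  by case: (i \in F); rewrite //= /nrm2 /= expr0n addr0.
move=> xE; move: Fx; rewrite -[ereal_sup _]/(sqsum x) xE fsumEFin // sqsum_l2.
rewrite -!EFinD lte_fin lee_fin; lra.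
Qed.

(* Also applied to conjugate-linear functions. *)
Lemma delta_ext0 (V : normedZmodType R[i]) (f : l2 R I -> V) (M : R) : 0 <= M ->
  {morph f : x y / x + y} -> (forall x, `|f x| <= M%:C%C * `|x|) ->
  (forall (c : R[i]) i, f (c *: delta i) = 0) -> forall x, f x = 0.
Proof.
move=> M0 fD fM f0 x; apply/eqP; rewrite -normr_le0.
have f00 : f 0 = 0.
  by apply/eqP; rewrite -normr_le0 (le_trans (fM 0)) // normr0 mulr0.
have fS (s : seq I) : f (\sum_(i <- s) x i *: delta i) = 0.
  by elim: s => [|i s IH]; rewrite ?big_nil // big_cons fD IH f0 addr0.
have fE : (complex.Re `|f x|)%:C%C = `|f x| by rewrite RRe_real ?ger0_real.
rewrite -fE lecR; apply/ler_addgt0Pr => e e0; rewrite add0r.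
(* The tolerance is e / (M + 1) because M may be 0. *)
have [s sx] := l2_approx x (divr_gt0 e0 (ltr_wpDr M0 ltr01)).
rewrite -lecR [X in X <= _]fE.
have -> : f x = f (x - \sum_(i <- s) x i *: delta i).
  have := fD (x - \sum_(i <- s) x i *: delta i) (\sum_(i <- s) x i *: delta i).
  by rewrite subrK fS addr0.
apply: (le_trans (fM _)); rewrite l2_normE -rmorphM lecR.
apply: (le_trans (ler_wpM2l M0 sx)); rewrite mulrC mulrAC -mulrA ler_piMr ?(ltW e0) //.
by rewrite ler_pdivrMr ?mul1r ?lerDr // ltr_wpDr.
Qed.

End Approximation.

(** * Composition and norm of bounded operators *)

Section OperatorBasics.
Context {R : realType}.

Lemma bopBE (V W : normedModType R[i]) (S T : bop V W) x : (S - T) x = S x - T x.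
Proof. by []. Qed.
Lemma bopDE (V W : normedModType R[i]) (S T : bop V W) x : (S + T) x = S x + T x.
Proof. by []. Qed.
Lemma bopZE (V W : normedModType R[i]) (c : R[i]) (T : bop V W) x : (c *: T) x = c *: T x.
Proof. by []. Qed.
Lemma bop_sumE (V W : normedModType R[i]) (T : Type) (s : seq T) (f : T -> bop V W) x :
  (\sum_(t <- s) f t) x = \sum_(t <- s) f t x.
Proof. by elim/big_ind2: _ => // a b c d; rewrite bopDE => -> ->. Qed.
Lemma bcompE (U V W : normedModType R[i]) (S : bop V W) (T : bop U V) x :
  bcomp S T x = S (T x).
Proof. by []. Qed.

Lemma bcompA (U V W X : normedModType R[i]) (S : bop W X) (T : bop V W) (P : bop U V) :
  bcomp S (bcomp T P) = bcomp (bcomp S T) P.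
Proof. exact: bopP. Qed.

Lemma bcompDl (U V W : normedModType R[i]) (S T : bop V W) (P : bop U V) :
  bcomp (S + T) P = bcomp S P + bcomp T P.
Proof. exact: bopP. Qed.
Lemma bcompBl (U V W : normedModType R[i]) (S T : bop V W) (P : bop U V) :
  bcomp (S - T) P = bcomp S P - bcomp T P.
Proof. exact: bopP. Qed.
Lemma bcompDr (U V W : normedModType R[i]) (P : bop V W) (S T : bop U V) :
  bcomp P (S + T) = bcomp P S + bcomp P T.
Proof. by apply: bopP => x; rewrite bcompE !bopDE linearD. Qed.
Lemma bcompBr (U V W : normedModType R[i]) (P : bop V W) (S T : bop U V) :
  bcomp P (S - T) = bcomp P S - bcomp P T.
Proof. by apply: bopP => x; rewrite bcompE !bopBE linearB. Qed.
Lemma bcompZl (U V W : normedModType R[i]) (c : R[i]) (S : bop V W) (P : bop U V) :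
  bcomp (c *: S) P = c *: bcomp S P.
Proof. exact: bopP. Qed.
Lemma bcompZr (U V W : normedModType R[i]) (c : R[i]) (P : bop V W) (S : bop U V) :
  bcomp P (c *: S) = c *: bcomp P S.
Proof. by apply: bopP => x; rewrite bcompE !bopZE linearZ. Qed.
Lemma bcomp1l (V W : normedModType R[i]) (S : bop V W) : bcomp (bid W) S = S.
Proof. exact: bopP. Qed.
Lemma bcomp1r (V W : normedModType R[i]) (S : bop V W) : bcomp S (bid V) = S.
Proof. exact: bopP. Qed.

Lemma opnorm_bcomp (U V W : normedModType R[i]) (S : bop V W) (T : bop U V) :
  opnorm (bcomp S T) <= opnorm S * opnorm T.
Proof.
apply: opnorm_le => [|x]; first by rewrite mulr_ge0 ?opnorm_ge0.
rewrite bcompE rmorphM -mulrA (le_trans (opnormP _ _)) // ler_wpM2l ?opnormP //.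
by rewrite ler0c opnorm_ge0.
Qed.

Lemma opnormD (V W : normedModType R[i]) (S T : bop V W) :
  opnorm (S + T) <= opnorm S + opnorm T.
Proof. by have := ler_normD S T; rewrite -rmorphD lecR. Qed.

Lemma opnormN (V W : normedModType R[i]) (T : bop V W) : opnorm (- T) = opnorm T.
Proof. by have := normrN T => /complexI. Qed.

Lemma bop_delta_ext (I : choiceType) (W : normedModType R[i]) (S T : bop (l2 R I) W) :
  (forall i, S (delta i) = T (delta i)) -> S = T.
Proof.
move=> ST; apply/eqP; rewrite -subr_eq0; apply/eqP.
have : forall i, (S - T) (delta i) = 0 by move=> i; rewrite bopBE ST subrr.
move: (S - T) => D D0; apply: bopP => x.
apply: (@delta_ext0 _ _ _ D (opnorm D)).
- exact: opnorm_ge0.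
- by move=> y z; rewrite linearD.
- exact: opnormP.
- by move=> c i; rewrite linearZ /= D0 scaler0.
Qed.

End OperatorBasics.

(** * Adjoints through matrix entries *)

Section Adjoint.
Context {R : realType}.

(** The difference of the two sides is bounded and additive in each variable, so [delta_ext0],
    applied in x and then in y, reduces the identity to basis vectors. *)
Lemma adjoint_opP (I J : choiceType) (T : bop (l2 R I) (l2 R J)) (S : bop (l2 R J) (l2 R I)) :
  (forall i j, T (delta i) j = ((S (delta j) i)^*)%C) -> adjoint_op T S.
Proof.
move=> TS x y; apply/eqP; rewrite -subr_eq0; apply/eqP.
have n0 (K : choiceType) (z : l2 R K) : 0 <= l2norm z by exact: l2norm_ge0.
apply: (@delta_ext0 _ _ _ (fun x => dot (T x) y - dot x (S y))
  (opnorm T * l2norm y + l2norm (S y))).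
- by rewrite addr_ge0 ?mulr_ge0 ?opnorm_ge0.
- by move=> u v; rewrite linearD !dotDl; ring.
- move=> u; rewrite rmorphD mulrDl rmorphM (le_trans (ler_normB _ _)) // lerD //.
    rewrite (le_trans (cauchy_schwarz _ _)) // mulrAC.
    by rewrite [leRHS]mulrC [leRHS]mulrC ler_wpM2r ?opnormP.
  by rewrite (le_trans (cauchy_schwarz _ _)) // mulrC.
move=> c i; rewrite linearZ /= !dotZl dot_delta -mulrBr.
suff -> : dot (T (delta i)) y - (S y) i = 0 by rewrite mulr0.
apply: (@delta_ext0 _ _ _ (fun y => dot (T (delta i)) y - (S y) i)
  (l2norm (T (delta i)) + opnorm S)).
- by rewrite addr_ge0 ?opnorm_ge0.
- by move=> u v; rewrite linearD !dotDr l2DE; ring.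
- move=> u; rewrite rmorphD mulrDl (le_trans (ler_normB _ _)) // lerD //.
    exact: cauchy_schwarz.
  rewrite -(dot_delta i) (le_trans (cauchy_schwarz _ _)) //.
  have -> : `|delta i : l2 R I| = 1.
    by apply/eqP; rewrite -(@eqrXn2 _ 2) // -dot_norm dot_delta deltaE eqxx expr1n.
  by rewrite mul1r opnormP.
move=> d j; have -> : S (d *: delta j) = d *: S (delta j) by rewrite linearZ.
by rewrite dotZr l2ZE dot_deltar TS conjcK subrr.
Qed.

Lemma adjoint_op_entry (I J : choiceType) (T : bop (l2 R I) (l2 R J))
    (S : bop (l2 R J) (l2 R I)) i j :
  adjoint_op T S -> T (delta i) j = ((S (delta j) i)^*)%C.
Proof.
by move=> /(_ (delta i) (delta j)); rewrite dot_deltar dot_delta => <-; rewrite conjcK.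
Qed.

Lemma adjoint_op_sym (I J : choiceType) (T : bop (l2 R I) (l2 R J))
    (S : bop (l2 R J) (l2 R I)) : adjoint_op T S -> adjoint_op S T.
Proof. by move=> TS x y; rewrite dotC -TS dotC conjcK. Qed.

(** This identifies an adjoint known abstractly, such as the image of [star a], with one written
    down by a formula. *)
Lemma adjoint_op_uniq (I J : choiceType) (T : bop (l2 R I) (l2 R J))
    (S S' : bop (l2 R J) (l2 R I)) : adjoint_op T S -> adjoint_op T S' -> S = S'.
Proof.
move=> TS TS'; apply: bop_delta_ext => j; apply: l2P => i.
by rewrite -[LHS]conjcK -[RHS]conjcK -(adjoint_op_entry _ _ TS) -(adjoint_op_entry _ _ TS').
Qed.

Lemma adjoint_bid (I : choiceType) : adjoint_op (bid (l2 R I)) (bid (l2 R I)).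
Proof. by []. Qed.

Lemma adjoint_bcomp (I J K : choiceType) (T : bop (l2 R I) (l2 R J)) T'
    (S : bop (l2 R J) (l2 R K)) S' :
  adjoint_op T T' -> adjoint_op S S' -> adjoint_op (bcomp S T) (bcomp T' S').
Proof. by move=> TT' SS' x y; rewrite !bcompE SS' TT'. Qed.

Lemma adjoint_opD (I J : choiceType) (S T : bop (l2 R I) (l2 R J)) S' T' :
  adjoint_op S S' -> adjoint_op T T' -> adjoint_op (S + T) (S' + T').
Proof. by move=> SS TT x y; rewrite !bopDE dotDl dotDr SS TT. Qed.

Lemma adjoint_opB (I J : choiceType) (S T : bop (l2 R I) (l2 R J)) S' T' :
  adjoint_op S S' -> adjoint_op T T' -> adjoint_op (S - T) (S' - T').
Proof. by move=> SS TT x y; rewrite !bopBE dotBl dotBr SS TT. Qed.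

End Adjoint.

(** * Tensor products of operators on basis vectors *)

Section TensorDelta.
Context {R : realType} {I J : choiceType}.

Lemma vtensE (x : l2 R I) (y : l2 R J) i j : vtens x y (i, j) = x i * y j.
Proof. by []. Qed.

Lemma vtensZl (c : R[i]) (x : l2 R I) (y : l2 R J) : vtens (c *: x) y = c *: vtens x y.
Proof. by apply: l2P => -[i j]; rewrite l2ZE !vtensE l2ZE mulrA. Qed.

Lemma vtensZr (c : R[i]) (x : l2 R I) (y : l2 R J) : vtens x (c *: y) = c *: vtens x y.
Proof. by apply: l2P => -[i j]; rewrite l2ZE !vtensE l2ZE mulrCA. Qed.

Lemma vtens0l (y : l2 R J) : vtens (0 : l2 R I) y = 0.
Proof. by apply: l2P => -[i j]; rewrite vtensE !l20E mul0r. Qed.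

Lemma vtens0r (x : l2 R I) : vtens x (0 : l2 R J) = 0.
Proof. by apply: l2P => -[i j]; rewrite vtensE !l20E mulr0. Qed.

Lemma delta_pair i j : (delta (i, j) : l2 R (I * J)%type) = vtens (delta i) (delta j).
Proof.
by apply: l2P => -[k l]; rewrite vtensE !deltaE xpair_eqE -natrM mulnb.
Qed.

Lemma tens_ext (W : normedModType R[i]) (S T : bop (l2 R (I * J)%type) W) :
  (forall i j, S (vtens (delta i) (delta j)) = T (vtens (delta i) (delta j))) -> S = T.
Proof. by move=> ST; apply: bop_delta_ext => -[i j]; rewrite delta_pair. Qed.

Lemma bcomp_tens (S S' : endop R I) (T T' : endop R J) :
  bcomp (tens S T) (tens S' T') = tens (bcomp S S') (bcomp T T').
Proof. by apply: tens_ext => i j; rewrite bcompE !tensE !bcompE. Qed.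

Lemma tens_bid : tens (bid (l2 R I)) (bid (l2 R J)) = bid _.
Proof. by apply: tens_ext => i j; rewrite tensE. Qed.

Lemma tensZl (c : R[i]) (S : endop R I) (T : endop R J) :
  tens (c *: S) T = c *: tens S T.
Proof. by apply: tens_ext => i j; rewrite bopZE !tensE bopZE vtensZl. Qed.

Lemma tens_linearr (S : endop R I) : linear (tens S : endop R J -> _).
Proof.
move=> c T T'; apply: tens_ext => i j; rewrite bopDE bopZE !tensE bopDE bopZE.
by apply: l2P => -[k l]; rewrite l2DE l2ZE !vtensE l2DE l2ZE; ring.
Qed.

Lemma adjoint_tens (S S' : endop R I) (T T' : endop R J) :
  adjoint_op S S' -> adjoint_op T T' -> adjoint_op (tens S T) (tens S' T').
Proof.
move=> SS TT; apply: adjoint_opP => -[i j] [k l].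
by rewrite !delta_pair !tensE !vtensE (adjoint_op_entry _ _ SS) (adjoint_op_entry _ _ TT) rmorphM.
Qed.

End TensorDelta.

(** * Bounded real diagonal operators *)

Section Diagonal.
Context {R : realType} {I : choiceType} (w : I -> R) (M : R).
Hypothesis wM : forall i, `|w i| <= M.

(** A negative M satisfies the hypothesis only over an empty index type, where every vector is 0. *)
Let M0 : M >= 0 \/ (I -> False).
Proof.
have [?|M0] := leP 0 M; first by left.
by right => i; have := le_trans (normr_ge0 (w i)) (wM i); rewrite leNgt M0.
Qed.

Lemma diag_sqsum (x : l2 R I) :
  (sqsum (fun i => (w i)%:C%C * x i)%R <= ((M * l2norm x) ^+ 2)%:E)%E.
Proof.
apply/sqsum_leP => X finX.
have /le_trans : \sum_(i \in X) nrm2 ((w i)%:C%C * x i) <=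
    \sum_(i \in X) M ^+ 2 * nrm2 (x i).
  rewrite !fsbig_finite //=; apply: ler_sum => i _; rewrite nrm2M.
  rewrite ler_wpM2r ?nrm2_ge0 // /nrm2 /= expr0n addr0 -real_normK ?num_real //.
  by rewrite lerXn2r ?nnegrE // (le_trans _ (wM i)).
apply; rewrite -mulr_fsumr exprMn ler_wpM2l ?sqr_ge0 //.
by move: X finX; apply/sqsum_leP; rewrite sqsum_l2.
Qed.

Lemma diag_subproof (x : l2 R I) :
  (fun i => (w i)%:C%C * x i) \in @sqsummable R I.
Proof. by apply/sqsummableP; eexists; exact: diag_sqsum. Qed.

Definition diag_fun (x : l2 R I) : l2 R I := L2 (diag_subproof x).

Lemma diag_normP x : `|diag_fun x| <= M%:C%C * `|x|.
Proof.
rewrite l2_normE -rmorphM lecR; case: M0 => [M_ge0|noI].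
  by apply: l2norm_le_sqsum; [rewrite mulr_ge0 ?l2norm_ge0|exact: diag_sqsum].
have -> : diag_fun x = 0 by apply: l2P => i; case: (noI i).
have -> : x = 0 by apply: l2P => i; case: (noI i).
have -> : l2norm (0 : l2 R I) = 0 by have /complexI := @normr0 _ (l2 R I).
by rewrite mulr0.
Qed.

Lemma diag_bounded : diag_fun \in @bounded_linear R (l2 R I) (l2 R I).
Proof.
apply: (bounded_linearP (M := M)) => [c x y|]; last exact: diag_normP.
apply: l2P => i.
transitivity ((w i)%:C%C * (c * x i + y i)) => //.
transitivity (c * ((w i)%:C%C * x i) + (w i)%:C%C * y i) => //.
ring.
Qed.

Definition diag : endop R I := Bop diag_bounded.

Lemma diagE x i : diag x i = (w i)%:C%C * x i. Proof. by []. Qed.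

Lemma diag_delta i : diag (delta i) = (w i)%:C%C *: delta i.
Proof.
apply: l2P => j; rewrite diagE l2ZE deltaE.
by case: eqP => [->|_] //; rewrite !mulr0.
Qed.

Lemma opnorm_diag : 0 <= M -> opnorm diag <= M.
Proof. by move=> ?; apply: opnorm_le => // x; exact: diag_normP. Qed.

Lemma adjoint_diag : adjoint_op diag diag.
Proof.
apply: adjoint_opP => i j; rewrite !diag_delta !l2ZE !deltaE eq_sym.
case: eqP => [->|_]; first by rewrite !mulr1 conjc_real.
by rewrite !mulr0 (conjc_real 0).
Qed.

End Diagonal.

(** * Adjoints of the shifts *)

Section ShiftAdjoint.
Context {R : realType}.

Lemma adjoint_reindex (I J : choiceType) (h : J -> I) (h_inj : injective h)
    (T : bop (l2 R J) (l2 R I)) : (forall j, T (delta j) = delta (h j)) ->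
  adjoint_op (reindex_op R h_inj) T.
Proof.
move=> Th; apply: adjoint_opP => i j; rewrite Th deltaE.
by rewrite /= conjc_nat eq_sym.
Qed.

Lemma adjoint_lshiftN : adjoint_op (lshiftN R) (ushift R).
Proof. by apply: adjoint_reindex => k; exact: ushiftE. Qed.

Definition rshiftZ : endop R int := reindex_op R (@addrI int (-1)).

Lemma rshiftZE l : rshiftZ (delta l) = delta (l + 1).
Proof. by apply: l2P => j; rewrite /= addrC subr_eq. Qed.

Lemma adjoint_lshiftZ : adjoint_op (lshiftZ R) rshiftZ.
Proof. by apply: adjoint_reindex => k; rewrite rshiftZE addrC. Qed.

End ShiftAdjoint.

Lemma complex_norm_le (R : realType) (a b : R) :
  `|(a +i* b)%C| <= (`|a| + `|b|)%:C%C.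
Proof.
rewrite normc_def lecR /= -[leRHS]ger0_norm ?addr_ge0 // -sqrtr_sqr ler_sqrt ?sqr_ge0 //.
rewrite -(real_normK (num_real a)) -(real_normK (num_real b)) sqrrD lerD2r lerDl.
by rewrite mulrn_wge0 // mulr_ge0.
Qed.

(** * Real-valued norms and closure arguments *)

Section RealNorm.
Context {R : realType} {V : normedModType R[i]}.

(** Norms here take values in R[i]; a real copy gives access to the total order of R and to linear
    arithmetic. *)
Definition rnorm (v : V) : R := complex.Re `|v|.

Lemma rnormE v : `|v| = (rnorm v)%:C%C.
Proof. by rewrite RRe_real ?ger0_real. Qed.

Lemma rnorm_ge0 v : 0 <= rnorm v.
Proof. by rewrite -ler0c -rnormE. Qed.

Lemma rnormD u v : rnorm (u + v) <= rnorm u + rnorm v.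
Proof. by rewrite -lecR rmorphD /= -!rnormE ler_normD. Qed.

Lemma rdistC u v : rnorm (u - v) = rnorm (v - u).
Proof. by rewrite /rnorm distrC. Qed.

Lemma rdist_triangle u v w : rnorm (u - w) <= rnorm (u - v) + rnorm (v - w).
Proof. by rewrite -[u - w](subrKA v) rnormD. Qed.

Lemma rnorm0_eq0 v : rnorm v = 0 -> v = 0.
Proof. by move=> v0; apply/eqP; rewrite -normr_eq0 rnormE v0. Qed.

Lemma rnormZ (c : R) v : 0 <= c -> rnorm (c%:C%C *: v) = c * rnorm v.
Proof.
by move=> c0; apply: (@complexI R); rewrite rmorphM /= -!rnormE normrZ ger0_norm // ler0c.
Qed.

Lemma closure_rnormP (G : set V) x :
  closure G x <-> forall e : R, 0 < e -> exists2 y, G y & rnorm (x - y) < e.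
Proof.
split=> [Gx e e0|Gx B /nbhs_ballP[r /= r0 rB]].
  have /Gx[y [Gy]] : nbhs x (ball x (e%:C%C)).
    by apply/nbhs_ballP; exists (e%:C%C) => //=; rewrite (@ltcR _ 0).
  by rewrite -ball_normE /ball_ /= rnormE ltcR => xy; exists y.
have rE : (complex.Re r)%:C%C = r by apply/RRe_real/gtr0_real.
have /Gx[y Gy xy] : 0 < complex.Re r by rewrite -(@ltcR _ 0) rE.
by exists y; split => //; apply: rB; rewrite -ball_normE /ball_ /= -rE rnormE ltcR.
Qed.

End RealNorm.

Section NormClosure.
Context {R : realType} {V W : normedModType R[i]}.

Lemma closure_opnormP (G : set (bop V W)) X :
  closure G X <-> forall e : R, 0 < e -> exists2 Y, G Y & opnorm (X - Y) < e.
Proof. exact: closure_rnormP. Qed.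

Lemma closed_opnorm (D : set (bop V W)) X : closed D ->
  (forall e : R, 0 < e -> exists2 Y, D Y & opnorm (X - Y) <= e) -> D X.
Proof.
move=> Dcl DX; apply: Dcl; apply/closure_opnormP => e e0.
have [Y DY XY] := DX (e / 2) (divr_gt0 e0 (ltr0Sn _ 1)).
by exists Y => //; apply: le_lt_trans XY _; rewrite ltr_pdivrMr // ltr_pMr // ltr1n.
Qed.

End NormClosure.

(** This is the common form of the density arguments for spatial tensor products: a property checked
    on finite sums passes to their norm limits. *)
Lemma closure_lipschitz (R : realType) (V W V' W' : normedModType R[i])
    (G : set (bop V W)) (D : set (bop V' W')) (f : bop V W -> bop V' W') (c : R) :
  closed D -> 0 <= c -> (forall X Y, opnorm (f X - f Y) <= c * opnorm (X - Y)) ->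
  (forall X, G X -> D (f X)) -> forall X, closure G X -> D (f X).
Proof.
move=> Dcl c0 fc fG X /closure_opnormP GX; apply: closed_opnorm => // e e0.
have [Y GY XY] := GX (e / (c + 1)) (divr_gt0 e0 (ltr_wpDl c0 ltr01)).
exists (f Y); first exact: fG.
apply: (le_trans (fc _ _)); apply: (le_trans (ler_wpM2l c0 (ltW XY))).
rewrite mulrC mulrAC -mulrA ler_piMr ?(ltW e0) //.
by rewrite ler_pdivrMr ?mul1r ?lerDl // ltr_wpDl.
Qed.

(** * Elements of the Toeplitz algebra *)

Section Toeplitz.
Context {R : realType}.

Lemma toeplitz_subalgebra : op_cstar_subalgebra (@toeplitz R).
Proof.
split.
- by move=> D [[]].
- by move=> c S T DS DT D Dsub; have [[_ + _ _ _] _] := Dsub; apply; [exact: DS|exact: DT].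
- by move=> S T DS DT D Dsub; have [[_ _ + _ _] _] := Dsub; apply; [exact: DS|exact: DT].
- by move=> S T ST DS D Dsub; have [[_ _ _ + _] _] := Dsub; apply; [exact: ST|exact: DS].
- by apply: closed_bigI => D [[]].
Qed.

Lemma toeplitz_ushift : toeplitz (ushift R).
Proof. by move=> D [_]; apply. Qed.

Lemma toeplitz_lshift : toeplitz (lshiftN R).
Proof.
have [_ _ _ + _] := toeplitz_subalgebra; apply; last exact: toeplitz_ushift.
by apply: adjoint_op_sym; exact: adjoint_lshiftN.
Qed.

Lemma toeplitz_bcomp (S T : endop R nat) : toeplitz S -> toeplitz T -> toeplitz (bcomp S T).
Proof. by have [_ _ + _ _] := toeplitz_subalgebra; apply. Qed.

Lemma toeplitzD (S T : endop R nat) : toeplitz S -> toeplitz T -> toeplitz (S + T).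
Proof. by move=> DS DT; rewrite -[S]scale1r; have [_ + _ _ _] := toeplitz_subalgebra; apply. Qed.

Lemma toeplitzZ (c : R[i]) (S : endop R nat) : toeplitz S -> toeplitz (c *: S).
Proof.
move=> DS; rewrite -[_ *: _]addr0; have [D0 + _ _ _] := toeplitz_subalgebra.
by apply.
Qed.

Lemma toeplitz_sum n (f : 'I_n -> endop R nat) :
  (forall k, toeplitz (f k)) -> toeplitz (\sum_(k < n) f k).
Proof.
move=> Df; elim/big_ind: _ => //; last exact: toeplitzD.
by have [] := toeplitz_subalgebra.
Qed.

Lemma toeplitz_bid : toeplitz (bid (l2 R nat)).
Proof.
(* The generated algebra contains the unit because the unilateral shift is an isometry. *)
suff <- : bcomp (lshiftN R) (ushift R) = bid _.
  by apply: toeplitz_bcomp; [exact: toeplitz_lshift|exact: toeplitz_ushift].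
by apply: bop_delta_ext => k; rewrite bcompE ushiftE lshiftNE.
Qed.

(** For the unilateral shift S with adjoint L, I - S L projects onto e_0, and P -> S P L carries the
    projection onto e_m to the one onto e_(m+1). *)
Lemma toeplitz_proj m : exists2 P : endop R nat, toeplitz P &
  forall k, P (delta k) = (k == m)%:R *: delta k.
Proof.
elim: m => [|m [P tP PE]].
  exists (bid _ + (- 1) *: bcomp (ushift R) (lshiftN R)).
    apply: toeplitzD; first exact: toeplitz_bid.
    apply: toeplitzZ; apply: toeplitz_bcomp.
      exact: toeplitz_ushift.
    exact: toeplitz_lshift.
  move=> k; rewrite bopDE bopZE bcompE lshiftNE; case: k => [|k].
    by rewrite linear0 scaler0 addr0 scale1r.
  by rewrite ushiftE scaleN1r subrr scale0r.
exists (bcomp (ushift R) (bcomp P (lshiftN R))).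
  apply: toeplitz_bcomp; first exact: toeplitz_ushift.
  by apply: toeplitz_bcomp => //; exact: toeplitz_lshift.
move=> k; rewrite !bcompE lshiftNE; case: k => [|k].
  by rewrite !linear0 scale0r.
by rewrite PE linearZ /= -[ushift_fun _]/(ushift R _) ushiftE.
Qed.

(** If L is the limit of w, then L I plus the finite-rank correction of the first N entries agrees
    with the diagonal below N and is off by w k - L, at most e in size, from N on. *)
Lemma toeplitz_diag (w : nat -> R) (M : R) (wM : forall k, `|w k| <= M) :
  cvgn w -> toeplitz (diag wM).
Proof.
move=> /cvg_ex[/= L wL]; have [_ _ _ _ tcl] := toeplitz_subalgebra.
apply: closed_opnorm => // e e0.
have [N _ wN] : \forall k \near \oo, `|L - w k| <= e by move/cvgrPdist_le: wL; apply.
have [P tP PE] : exists2 P : nat -> endop R nat, forall m, toeplitz (P m) &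
    forall m k, P m (delta k) = (k == m)%:R *: delta k.
  have /choice[P HP] : forall m, exists P : endop R nat, toeplitz P /\
      forall k, P (delta k) = (k == m)%:R *: delta k.
    by move=> m; have [P ? ?] := toeplitz_proj m; exists P.
  by exists P => m; case: (HP m).
exists (L%:C%C *: bid _ + \sum_(m < N) (w m - L)%:C%C *: P m).
  apply: toeplitzD; first by apply: toeplitzZ; exact: toeplitz_bid.
  by apply: toeplitz_sum => m; apply: toeplitzZ.
pose v k := if (k < N)%N then 0 else w k - L.
have ve k : `|v k| <= e.
  rewrite /v; case: ltnP => [_|Nk]; first by rewrite normr0 ltW.
  by rewrite distrC; exact: wN.
rewrite (_ : _ - _ = diag ve); first by apply: opnorm_diag; exact: ltW.
apply: bop_delta_ext => k.
rewrite bopBE bopDE bopZE bop_sumE !diag_delta -[bid _ _]/(delta k).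
rewrite (eq_bigr (fun m : 'I_N => if m == k :> nat then (w k - L)%:C%C *: delta k else 0));
  last first.
  move=> m _; rewrite bopZE PE eq_sym; case: eqP => [->|_]; rewrite ?scale1r //.
  by rewrite scale0r scaler0.
rewrite /v; case: ltnP => [kN|Nk].
  rewrite (bigD1 (Ordinal kN)) //= eqxx big1 ?addr0; last first.
    by move=> i /eqP ik; case: eqP => // ik'; case: ik; exact: val_inj.
  by rewrite -scalerDl -scalerBl -rmorphD -rmorphB; congr (_%:C%C *: _); ring.
rewrite big1 ?addr0; last first.
  by move=> i _; case: eqP => // ik; move: (ltn_ord i); rewrite ik ltnNge Nk.
by rewrite -scalerBl -rmorphB.
Qed.

End Toeplitz.

(** * Compact operators: ideal property and rank-one diagonals *)

Section Compact.
Context {R : realType} {J : choiceType}.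
Implicit Types (K S : endop R J).

Lemma compact_bcompl S K : compact_op K -> compact_op (bcomp S K).
Proof.
rewrite /compact_op /= precompactE => Kc.
have Sc : compact (S @` closure (K @` [set x | `|x| <= 1])).
  by apply: continuous_compact => //; apply: continuous_subspaceT; exact: bop_continuous.
apply: (@precompact_subset _ _ (S @` closure (K @` [set x | `|x| <= 1]))); last first.
  by rewrite precompact_closed //; apply: compact_closed => //; exact: norm_hausdorff.
move=> _ [x x1 <-]; exists (K x) => //; apply: subset_closure.
by exists x.
Qed.

Lemma compact_bcompr S K : compact_op K -> compact_op (bcomp K S).
Proof.
(* M is positive even if S = 0, and S / M maps the unit ball into itself; hence K S sends the unit
   ball into the image of that ball under M K. *)
move=> Kc; pose M : R := opnorm S + 1.
have M0 : 0 < M by rewrite ltr_wpDl // opnorm_ge0.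
have := compact_bcompl (M%:C%C *: bid _) Kc; rewrite /compact_op /=.
apply: precompact_subset => _ [x x1 <-].
exists ((M^-1)%:C%C *: S x) => /=.
  rewrite normrZ ger0_norm ?ler0c ?invr_ge0 ?(ltW M0) //.
  rewrite (le_trans (ler_wpM2l _ (opnormP S x))) ?ler0c ?invr_ge0 ?(ltW M0) //.
  rewrite mulrA -rmorphM (le_trans (ler_wpM2l _ x1)) //.
    by rewrite ler0c mulr_ge0 ?opnorm_ge0 ?invr_ge0 ?(ltW M0).
  by rewrite mulr1 -[1]/((1:R)%:C%C) lecR mulrC ler_pdivrMr // mul1r lerDl.
have KZ : K ((M^-1)%:C%C *: S x) = (M^-1)%:C%C *: K (S x) by rewrite linearZ.
transitivity (M%:C%C *: K ((M^-1)%:C%C *: S x)) => //.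
rewrite KZ scalerA -rmorphM divff ?scale1r //.
by rewrite gt_eqF.
Qed.

(** The image of the unit ball consists of multiples of e_p whose real and imaginary parts lie in
    [-M, M], so it sits in a continuous image of a compact square. *)
Lemma compact_delta_proj (p : J) (w : J -> R) (M : R) (wM : forall j, `|w j| <= M) :
  (forall j, j != p -> w j = 0) -> compact_op (diag wM).
Proof.
move=> w0.
pose g (u : R * R) : l2 R J := (u.1 +i* u.2)%C *: delta p.
have nd : `|delta p : l2 R J| = 1.
  by apply/eqP; rewrite -(@eqrXn2 _ 2) // -dot_norm dot_delta deltaE eqxx expr1n.
have gB u v : g u - g v = ((u.1 - v.1) +i* (u.2 - v.2))%C *: delta p.
  by rewrite /g -scalerBl.
have gc : continuous g.
  move=> u; apply/cvgrPdist_le => e e0.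
  have eE : (complex.Re e)%:C%C = e by apply/RRe_real/gtr0_real.
  have Re0 : 0 < complex.Re e by rewrite -(@ltcR _ 0) eE.
  apply/(@nbhs_ballP R (R * R)%type u); exists (complex.Re e / 2) => /= [|v [uv1 uv2]].
    by rewrite divr_gt0.
  rewrite gB normrZ nd mulr1 -eE.
  rewrite (le_trans (complex_norm_le _ _)) // lecR.
  move: uv1 uv2; rewrite /ball /= => /ltW ? /ltW ?.
  by rewrite [leRHS](splitr (complex.Re e)) lerD.
have gK : compact (g @` (`[- M, M] `*` `[- M, M])).
  apply: continuous_compact; first by apply: continuous_subspaceT; exact: gc.
  by apply: compact_setX; exact: segment_compact.
apply: (precompact_subset (B := g @` (`[- M, M] `*` `[- M, M]))); last first.
  by rewrite precompact_closed //; apply: compact_closed => //; exact: norm_hausdorff.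
move=> _ [x x1 <-].
have xE : diag wM x = g (complex.Re ((w p)%:C%C * x p), complex.Im ((w p)%:C%C * x p)).
  apply: l2P => j; rewrite diagE /g l2ZE deltaE.
  rewrite (_ : (_ +i* _)%C = (w p)%:C%C * x p); last by case: (_ * _).
  by case: eqP => [->|/eqP/w0 ->]; rewrite ?mulr1 ?mulr0 // mul0r.
have xp : nrm2 (x p) <= 1.
  apply: (le_trans (nrm2_le_l2norm x p)).
  by rewrite expr_le1 ?l2norm_ge0 // -lecR.
rewrite xE; eexists; last reflexivity.
have [M1 [xr xi]] : 0 <= M /\ `|complex.Re (x p)| <= 1 /\ `|complex.Im (x p)| <= 1.
  split; first exact: le_trans (wM p).
  move: xp; rewrite /nrm2; move: (complex.Re _) (complex.Im _) => a b ab.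
  by rewrite !ler_norml; split; apply/andP; split; nra.
split => /=; rewrite in_itv /= -ler_norml.
  rewrite (_ : complex.Re _ = w p * complex.Re (x p)); last by case: (x p) => a b /=; ring.
  by rewrite normrM -[M]mulr1 ler_pM.
rewrite (_ : complex.Im _ = w p * complex.Im (x p)); last by case: (x p) => a b /=; ring.
by rewrite normrM -[M]mulr1 ler_pM.
Qed.

End Compact.

(** * Spatial tensor products as norm closures *)

Section SpatialTensor.
Context {R : realType} {I J : choiceType}.
Variables (B : set (endop R I)) (D : set (endop R J)).
Implicit Types X Y Z : endop R (I * J)%type.

Definition alg_tensor : set (endop R (I * J)%type) :=
  [set X | exists n (b : 'I_n -> endop R I) (d : 'I_n -> endop R J),
    [/\ forall k, B (b k), forall k, D (d k) & X = \sum_(k < n) tens (b k) (d k)]].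

Local Notation BD := (spatial_tensor B D).

Lemma spatial_tensor_closed : closed BD.
Proof. exact: closed_closure. Qed.

Lemma alg_tensor0 : alg_tensor 0.
Proof.
exists 0%N, (fun=> 0), (fun=> 0); split; [by case|by case|].
by rewrite big_ord0.
Qed.

Lemma alg_tensor_pure b d : B b -> D d -> alg_tensor (tens b d).
Proof.
by move=> Bb Dd; exists 1%N, (fun=> b), (fun=> d); split => //; rewrite big_ord1.
Qed.

Lemma alg_tensorD X Y : alg_tensor X -> alg_tensor Y -> alg_tensor (X + Y).
Proof.
move=> [n [b [d [Bb Dd ->]]]] [m [b' [d' [Bb' Dd' ->]]]].
pose glue (T : Type) (f : 'I_n -> T) (g : 'I_m -> T) (k : 'I_(n + m)) :=
  match fintype.split k with inl i => f i | inr i => g i end.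
exists (n + m)%N, (glue _ b b'), (glue _ d d'); split.
- by move=> k; rewrite /glue; case: fintype.split.
- by move=> k; rewrite /glue; case: fintype.split.
rewrite big_split_ord /=; congr (_ + _); apply: eq_bigr => k _; rewrite /glue.
  by rewrite (unsplitK (inl k)).
by rewrite (unsplitK (inr k)).
Qed.

Lemma spatial_tensor_pure b d : B b -> D d -> BD (tens b d).
Proof. by move=> Bb Dd; apply: subset_closure; exact: alg_tensor_pure. Qed.

Lemma spatial_tensor0 : BD 0.
Proof. by apply: subset_closure; exact: alg_tensor0. Qed.

Lemma spatial_tensorD X Y : BD X -> BD Y -> BD (X + Y).
Proof.
(* Addition is treated one variable at a time: Y is first replaced by a finite sum with X fixed in
   the closure, then X is. *)
move=> BX; move: Y; apply: (closure_lipschitz (c := 1)) => //.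
- exact: spatial_tensor_closed.
- by move=> Y Z; rewrite mul1r opprD addrACA subrr add0r.
move=> Y GY; move: X BX; apply: (closure_lipschitz (c := 1)) => //.
- exact: spatial_tensor_closed.
- by move=> X Z; rewrite mul1r opprD addrACA subrr addr0.
by move=> X GX; apply: subset_closure; exact: alg_tensorD.
Qed.

Lemma spatial_tensor_sum (T : Type) (s : seq T) (P : pred T) (f : T -> endop R (I * J)%type) :
  (forall t, P t -> BD (f t)) -> BD (\sum_(t <- s | P t) f t).
Proof.
move=> Bf; elim/big_ind: _ => //; first exact: spatial_tensor0.
exact: spatial_tensorD.
Qed.

(** S and T themselves may lie outside [B] and [D]; they only have to multiply these sets into
    themselves. This covers any bounded T acting on the compacts. *)
Lemma spatial_tensor_bcompl S T X : (forall b, B b -> B (bcomp S b)) ->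
  (forall d, D d -> D (bcomp T d)) -> BD X -> BD (bcomp (tens S T) X).
Proof.
move=> SB TD; move: X; apply: (closure_lipschitz (c := opnorm (tens S T))).
- exact: spatial_tensor_closed.
- exact: opnorm_ge0.
- by move=> X Y; rewrite -bcompBr opnorm_bcomp.
move=> _ [n [b [d [Bb Dd ->]]]].
rewrite (_ : bcomp _ _ = \sum_(k < n) tens (bcomp S (b k)) (bcomp T (d k))).
  by apply: spatial_tensor_sum => k _; apply: spatial_tensor_pure; auto.
apply: bopP => x; rewrite bcompE !bop_sumE linear_sum.
by apply: eq_bigr => k _; rewrite -bcomp_tens.
Qed.

Lemma spatial_tensor_bcompr S T X : (forall b, B b -> B (bcomp b S)) ->
  (forall d, D d -> D (bcomp d T)) -> BD X -> BD (bcomp X (tens S T)).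
Proof.
move=> SB TD; move: X; apply: (closure_lipschitz (c := opnorm (tens S T))).
- exact: spatial_tensor_closed.
- exact: opnorm_ge0.
- by move=> X Y; rewrite -bcompBl mulrC opnorm_bcomp.
move=> _ [n [b [d [Bb Dd ->]]]].
rewrite (_ : bcomp _ _ = \sum_(k < n) tens (bcomp (b k) S) (bcomp (d k) T)).
  by apply: spatial_tensor_sum => k _; apply: spatial_tensor_pure; auto.
apply: bopP => x; rewrite bcompE !bop_sumE.
by apply: eq_bigr => k _; rewrite -bcomp_tens.
Qed.

Lemma spatial_tensorZ c X : (forall b, B b -> B (c *: b)) -> BD X -> BD (c *: X).
Proof.
(* The scalar is moved into the first factor: c X = (c I (x) I) X. *)
move=> cB BX; rewrite -[X](bcomp1l X) -bcompZl -tens_bid -tensZl.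
apply: spatial_tensor_bcompl => //; last by move=> d; rewrite bcomp1l.
by move=> b Bb; rewrite bcompZl bcomp1l; exact: cB.
Qed.

(** Only X is approximated by finite sums; each elementary tensor then multiplies Y inside the
    closure. *)
Lemma spatial_tensor_bcomp X Y :
  (forall b b', B b -> B b' -> B (bcomp b b')) ->
  (forall d d', D d -> D d' -> D (bcomp d d')) ->
  BD X -> BD Y -> BD (bcomp X Y).
Proof.
move=> BB DD BX BY; move: X BX; apply: (closure_lipschitz (c := opnorm Y)).
- exact: spatial_tensor_closed.
- exact: opnorm_ge0.
- by move=> X Z; rewrite -bcompBl mulrC opnorm_bcomp.
move=> _ [n [b [d [Bb Dd ->]]]].
rewrite (_ : bcomp _ _ = \sum_(k < n) bcomp (tens (b k) (d k)) Y).
  by apply: spatial_tensor_sum => k _; apply: spatial_tensor_bcompl; auto.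
by apply: bopP => x; rewrite bcompE !bop_sumE.
Qed.

End SpatialTensor.

(** * The ideal Toeplitz (x) compacts *)

Section ToeplitzCompact.
Context {R : realType} {J : choiceType}.
Local Notation TK := (spatial_tensor (@toeplitz R) (@compact_op R J)).
Implicit Types X Y : endop R (nat * J)%type.

Lemma toeplitz_compactZ c X : TK X -> TK (c *: X).
Proof. by apply: spatial_tensorZ => b; exact: toeplitzZ. Qed.

(** T is arbitrary because the compacts are an ideal. With S = I this makes every I (x) pi(a) a
    multiplier. *)
Lemma toeplitz_compact_multiplier (S : endop R nat) (T : endop R J) :
  toeplitz S -> multiplier TK (tens S T).
Proof.
move=> tS e BKe; split.
  apply: spatial_tensor_bcompl => // [b tb|d]; first exact: toeplitz_bcomp.
  exact: compact_bcompl.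
apply: spatial_tensor_bcompr => // [b tb|d]; first exact: toeplitz_bcomp.
exact: compact_bcompr.
Qed.

Lemma toeplitz_compact_bcomp X Y : TK X -> TK Y -> TK (bcomp X Y).
Proof.
apply: spatial_tensor_bcomp => [b b'|d d' Dd _]; first exact: toeplitz_bcomp.
exact: compact_bcompr.
Qed.

Lemma toeplitz_compact_diag (w : nat * J -> R) (M : R) (wM : forall p, `|w p| <= M) :
  (forall j, cvgn (fun m => w (m, j))) ->
  (forall e : R, 0 < e -> exists s : seq J,
     forall m j, j \notin s -> `|w (m, j)| <= e) ->
  TK (diag wM).
Proof.
move=> wc wu; apply: closed_opnorm; first exact: spatial_tensor_closed.
(* Duplicates are removed since a repeated j would count its projection twice in the sum below. *)
move=> e e0; have [s0 ws0] := wu e e0; pose s := undup s0.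
have ws m j : j \notin s -> `|w (m, j)| <= e by rewrite mem_undup; exact: ws0.
have wjM j m : `|w (m, j)| <= M by exact: wM.
have uj1 (j k : J) : `|(k == j)%:R : R| <= 1.
  by case: (k == j); rewrite ?normr1 ?normr0.
exists (\sum_(j <- s) tens (diag (wjM j)) (diag (uj1 j))).
  apply: spatial_tensor_sum => j _; apply: spatial_tensor_pure.
    exact: toeplitz_diag.
  by apply: (@compact_delta_proj _ _ j) => k /negbTE ->.
pose v (p : nat * J) := if p.2 \in s then 0 else w p.
have ve p : `|v p| <= e.
  rewrite /v; case: p => m j /=; case: ifPn => [_|/ws //]; by rewrite normr0 ltW.
rewrite (_ : _ - _ = diag ve); first by apply: opnorm_diag; exact: ltW.
apply: bop_delta_ext => -[m j].
rewrite bopBE bop_sumE !diag_delta.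
rewrite (eq_bigr (fun k => if k == j then (w (m, j))%:C%C *: delta (m, j) else 0));
  last first.
  move=> k _; rewrite delta_pair tensE !diag_delta vtensZl vtensZr eq_sym.
  by case: eqP => [->|_]; rewrite ?scale1r // scale0r scaler0.
rewrite -big_mkcond /v /=; case: ifPn => js.
  rewrite (big_rem j) //= eqxx big_seq_cond big1 ?addr0 ?subrr ?scale0r // => k.
  by rewrite mem_rem_uniq ?undup_uniq // inE => /andP[/andP[/negbTE ->]].
rewrite big_seq_cond big1 ?subr0 // => k /andP[+ /eqP kj].
by rewrite kj (negbTE js).
Qed.

End ToeplitzCompact.

(** * A square root of 1 - h, and contractivity of unital representations *)

Section CstarSqrt.
Context {R : realType} {A : cstarType R}.
Implicit Types a b h : A.

Lemma rnorm_cmul a b : rnorm (a ** b) <= rnorm a * rnorm b.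
Proof. by rewrite -lecR rmorphM /= -!rnormE; exact: cstar_normM. Qed.

Lemma rnorm_starM a : rnorm (star a ** a) = rnorm a ^+ 2.
Proof. by apply: (@complexI R); rewrite rmorphXn /= -!rnormE; exact: cstar_identity. Qed.

(** The C*-identity and submultiplicativity bound |b|^2 by the product of |b| and the norm of its
    adjoint; this is used for a and for [star a]. *)
Lemma rnorm_star a : rnorm (star a) = rnorm a.
Proof.
have le_star b : rnorm b <= rnorm (star b).
  have [->|b0] := eqVneq (rnorm b) 0; first exact: rnorm_ge0.
  have b_gt0 : 0 < rnorm b by rewrite lt_def b0 rnorm_ge0.
  by rewrite -(ler_pM2r b_gt0) -expr2 -rnorm_starM rnorm_cmul.
by apply/eqP; rewrite eq_le le_star -{2}[a]starK le_star.
Qed.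

Lemma starB a b : star (a - b) = star a - star b.
Proof.
by rewrite starD -scaleN1r starZ rmorphN rmorph1 scaleN1r.
Qed.

Lemma cmulBr a b c : a ** (b - c) = a ** b - a ** c.
Proof. by rewrite cmulDr -scaleN1r cmulZr scaleN1r. Qed.

Lemma cmulBl a b c : (a - b) ** c = a ** c - b ** c.
Proof. by rewrite cmulDl -scaleN1r cmulZl scaleN1r. Qed.

Lemma star_cone : star (cone : A) = cone.
Proof. by rewrite -[LHS]cmula1 -{2}[cone]starK -starM cmula1 starK. Qed.

Section FixedPoint.
Variables (h : A) (s : R).
Hypotheses (hs : rnorm h <= s) (s1 : s < 1) (h_star : star h = h).

Let s0 : 0 <= s. Proof. exact: le_trans (rnorm_ge0 h) hs. Qed.

(* If z = (h + z ^ 2) / 2 then (1 - z) ^ 2 = 1 - h. *)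
Let F (z : A) : A := (2^-1)%:C%C *: (h + z ** z).
Let z n := iter n F 0.

Let h20 : (0 : R) <= 2^-1. Proof. by rewrite invr_ge0. Qed.

(** The identity a^2 - b^2 = a (a - b) + (a - b) b needs no commutativity. With c = s < 1 it makes F
    a contraction of the ball of radius s. *)
Let F_lipschitz a b c : rnorm a <= c -> rnorm b <= c ->
  rnorm (F a - F b) <= c * rnorm (a - b).
Proof.
move=> ac bc; rewrite /F -scalerBr rnormZ // opprD addrACA subrr add0r.
have -> : a ** a - b ** b = a ** (a - b) + (a - b) ** b.
  by rewrite cmulBr cmulBl addrA subrK.
rewrite ler_pdivrMl // (le_trans (rnormD _ _)) //.
have H1 := le_trans (rnorm_cmul a (a - b)) (ler_wpM2r (rnorm_ge0 _) ac).
have H2 := le_trans (rnorm_cmul (a - b) b) (ler_wpM2l (rnorm_ge0 _) bc).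
lra.
Qed.

(** The iteration starts at 0 and (s + s^2) / 2 <= s, so it never leaves the ball of radius s. *)
Let z_le n : rnorm (z n) <= s.
Proof.
elim: n => [|n IH]; first by rewrite /z /= /rnorm normr0.
rewrite /z /= -/(z n) /F rnormZ // ler_pdivrMl // (le_trans (rnormD _ _)) //.
have H1 := le_trans (rnorm_cmul (z n) (z n)) (ler_pM (rnorm_ge0 _) (rnorm_ge0 _) IH IH).
have H2 : 0 <= s * (1 - s) by rewrite mulr_ge0 // subr_ge0 ltW.
apply: (le_trans (lerD hs H1)); lra.
Qed.

Let z_step n : rnorm (z n.+1 - z n) <= s ^+ n.
Proof.
elim: n => [|n IH].
  by rewrite /z /= subr0 (le_trans (z_le 1)) // expr0 ltW.
rewrite exprS; apply: (le_trans (F_lipschitz (z_le n.+1) (z_le n))).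
by rewrite ler_wpM2l.
Qed.

Let z_dist n m : rnorm (z (n + m)%N - z n) <= s ^+ n / (1 - s).
Proof.
have s10 : 0 < 1 - s by rewrite subr_gt0.
suff H : rnorm (z (n + m)%N - z n) <= (s ^+ n - s ^+ (n + m)) / (1 - s).
  rewrite (le_trans H) // ler_pM2r ?invr_gt0 // gerBl exprn_ge0 //.
elim: m => [|m IH]; first by rewrite addn0 !subrr mul0r /rnorm normr0.
rewrite (le_trans (rdist_triangle _ (z (n + m)%N) _)) // addnS.
rewrite (le_trans (lerD (z_step _) IH)) //.
suff E : s ^+ (n + m) = (s ^+ (n + m) - s ^+ (n + m).+1) / (1 - s).
  by rewrite {1}E -mulrDl ler_pM2r ?invr_gt0 //; lra.
by rewrite exprSr -{2}[s ^+ _]mulr1 -mulrBr mulfK // gt_eqF.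
Qed.

Let z_cvg : cvgn z.
Proof.
have s10 : 0 < 1 - s by rewrite subr_gt0.
apply/cauchy_cvgP; apply/cauchy_ballP => e e0; near_simpl.
have eE : (complex.Re e)%:C%C = e by apply/RRe_real/gtr0_real.
have Re0 : 0 < complex.Re e by rewrite -(@ltcR _ 0) eE.
have [N _ HN] : \forall n \near \oo, `|0 - s ^+ n| < complex.Re e * (1 - s) / 2.
  have /cvgrPdist_lt : s ^+ n @[n --> \oo] --> (0 : R).
    by apply: cvg_expr; rewrite ger0_norm.
  by apply; rewrite divr_gt0 // mulr_gt0.
have sN : s ^+ N / (1 - s) < complex.Re e / 2.
  rewrite ltr_pdivrMr // mulrAC.
  by have := HN N (leqnn N); rewrite sub0r normrN ger0_norm ?exprn_ge0.
exists ([set n | N <= n], [set n | N <= n])%N; first by split; exists N.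
move=> [n m] [/= Nn Nm]; rewrite -ball_normE /ball_ /= -eE rnormE ltcR.
rewrite (le_lt_trans (rdist_triangle _ (z N) _)) // (splitr (complex.Re e)) ltrD //.
  by rewrite -(subnKC Nn) (le_lt_trans (z_dist _ _)).
by rewrite rdistC -(subnKC Nm) (le_lt_trans (z_dist _ _)).
Qed.

(** Two consecutive iterates close to the limit are what is needed to pass z (n+1) = F (z n) to the
    limit by norm estimates alone. *)
Let z_lim : exists l : A, forall e : R, 0 < e -> exists n,
  rnorm (l - z n) < e /\ rnorm (l - z n.+1) < e.
Proof.
exists (limn z) => e e0; have /cvgrPdist_lt/(_ (e%:C%C)) := z_cvg.
rewrite (@ltcR _ 0) => /(_ e0)[N _ HN]; exists N.
by rewrite -!(@ltcR R) -!rnormE; split; apply: HN => /=.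
Qed.

Lemma cstar_sqrt : exists y : A, star y = y /\ y ** y = cone - h.
Proof.
have [l lz] := z_lim.
have small x (c : R) : 0 <= c -> (forall e, 0 < e -> rnorm x <= c * e) -> x = 0 :> A.
  move=> c0 xe; apply: rnorm0_eq0; apply/eqP; rewrite eq_le rnorm_ge0 andbT.
  apply/ler_addgt0Pr => e e0; rewrite add0r.
  apply: (le_trans (xe (e / (c + 1)) _)); first by rewrite divr_gt0 // ltr_wpDl.
  rewrite mulrC mulrAC -mulrA ler_piMr ?(ltW e0) //.
  by rewrite ler_pdivrMr ?mul1r ?lerDl // ltr_wpDl.
have zstar n : star (z n) = z n.
  elim: n => [|n IH]; first by rewrite /z /= -(subrr h) starB h_star.
  rewrite /z /= -/(z n) /F starZ starD starM IH h_star; congr (_ *: _).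
  exact: conjc_real.
have lstar : star l = l.
  apply/eqP; rewrite -subr_eq0; apply/eqP; apply: (small _ 2) => // e e0.
  have [n [ln _]] := lz e e0.
  rewrite (le_trans (rdist_triangle _ (z n) _)) // -{1}(zstar n) -starB rnorm_star.
  rewrite (rdistC (z n)); lra.
have lF : l = F l.
  apply/eqP; rewrite -subr_eq0; apply/eqP.
  (* [F_lipschitz] asks for one bound valid for both l and the iterates; s + |l| serves without
     first bounding |l|. *)
  have c0 : 0 <= s + rnorm l by rewrite addr_ge0 ?rnorm_ge0.
  apply: (small _ (1 + (s + rnorm l))) => [|e e0]; first by rewrite addr_ge0.
  have [n [ln lSn]] := lz e e0.
  rewrite (le_trans (rdist_triangle _ (z n.+1) _)) // mulrDl mul1r lerD ?(ltW lSn) //.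
  rewrite [z n.+1]/(F (z n)) (le_trans (F_lipschitz (c := s + rnorm l) _ _)) //.
  - by rewrite (le_trans (z_le n)) // lerDl rnorm_ge0.
  - by rewrite lerDr.
  - by rewrite ler_wpM2l // rdistC ltW.
exists (cone - l); split; first by rewrite starB star_cone lstar.
have l2 : l + l = h + l ** l.
  rewrite {1 2}lF /F -scalerDl -rmorphD.
  rewrite (_ : 2^-1 + 2^-1 = 1 :> R) ?scale1r //; lra.
rewrite cmulBr cmula1 cmulBl cmul1a.
rewrite -addrA; congr (_ + _); rewrite opprB addrCA -opprD.
by rewrite l2 opprD addrCA subrr addr0.
Qed.

End FixedPoint.

Lemma unital_star_rep_contractive (I : choiceType) (f : A -> endop R I) a :
  unital_star_rep f -> opnorm (f a) <= rnorm a.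
Proof.
move=> [[flin fM fstar] f1].
pose fL : {linear A -> endop R I} := HB.pack f (GRing.isLinear.Build R[i] A _ *:%R f flin).
have fB x y : f (x - y) = f x - f y := raddfB fL x y.
have fZ c x : f (c *: x) = c *: f x := linearZ_LR fL c x.
have le1 b v : rnorm b < 1 -> l2norm (f b v) <= l2norm v.
  move=> b1.
  have hb : rnorm (star b ** b) <= rnorm b ^+ 2 by rewrite rnorm_starM.
  have hb1 : rnorm b ^+ 2 < 1 by rewrite expr_lt1 ?rnorm_ge0.
  have [|y [ys yy]] := cstar_sqrt hb hb1; first by rewrite starM starK.
  (* The left side is <v, f (1 - b^* b) v>, where f(1) = I is used, and f (1 - b^* b) = f(y) f(y)
     with f(y) self-adjoint. *)
  have : (l2norm v ^+ 2)%:C%C - (l2norm (f b v) ^+ 2)%:C%C = (l2norm (f y v) ^+ 2)%:C%C.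
    rewrite -!dot_l2norm !(fstar _ _ _) ys -dotBr -!bcompE -!fM yy fB f1.
    by rewrite bopBE.
  rewrite -rmorphB => /complexI /eqP; rewrite subr_eq => /eqP E.
  by rewrite -(@ler_pXn2r _ 2) ?nnegrE ?l2norm_ge0 // E lerDr sqr_ge0.
(* Division by |a| + e brings a to norm below 1, also when a = 0. *)
apply/ler_addgt0Pr => e e0; set t := rnorm a + e.
have t0 : 0 < t by rewrite ltr_wpDl ?rnorm_ge0.
apply: opnorm_le => [|v]; first exact: ltW.
have tE : a = t%:C%C *: ((t^-1)%:C%C *: a).
  by rewrite scalerA -rmorphM divff ?scale1r // gt_eqF.
rewrite {1}tE fZ bopZE normrZ ger0_norm ?ler0c ?(ltW t0) // ler_wpM2l ?ler0c ?(ltW t0) //.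
rewrite !l2_normE lecR; apply: le1.
rewrite rnormZ ?invr_ge0 ?(ltW t0) // mulrC ltr_pdivrMr // mul1r ltrDl //.
Qed.

End CstarSqrt.

(** * From generators to the whole algebra *)

Section QuasihomCriterion.
Context {R : realType} {A : cstarType R} {J : choiceType}.
Local Notation TK := (spatial_tensor (@toeplitz R) (@compact_op R J)).
Variables (p1 p2 : A -> endop R (nat * J)%type) (G : set A).
Hypotheses (p1_rep : unital_star_rep p1) (p2_rep : unital_star_rep p2).
Hypothesis p2_mult : forall a, multiplier TK (p2 a).
Hypothesis G_gen : smallest (@cstar_subalgebra R A) G = [set: A].
Hypothesis G_diff : forall a, G a -> TK (p1 a - p2 a) /\ TK (p1 (star a) - p2 (star a)).

Let Delta a := p1 a - p2 a.

Let DeltaE c a b : Delta (c *: a + b) = c *: Delta a + Delta b.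
Proof.
have [[p1l _ _] _] := p1_rep; have [[p2l _ _] _] := p2_rep.
by rewrite /Delta p1l p2l scalerBr opprD addrACA.
Qed.

Let Delta0 : Delta 0 = 0.
Proof.
by have := DeltaE (-1) 0 0; rewrite !scaleN1r oppr0 addr0 addNr.
Qed.

(** In this product rule only [p2] occurs outside [Delta], so [p2_mult] is enough; that p1 = Delta +
    p2 consists of multipliers comes out at the end. *)
Let DeltaM a b : Delta (a ** b) =
  bcomp (Delta a) (Delta b) + (bcomp (Delta a) (p2 b) + bcomp (p2 a) (Delta b)).
Proof.
have [[_ p1M _] _] := p1_rep; have [[_ p2M _] _] := p2_rep.
rewrite /Delta p1M p2M !bcompBl !bcompBr.
by rewrite (addrC (bcomp (p1 a) (p2 b) - _)) addrA subrK subrKA.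
Qed.

Let Delta_lipschitz a b : opnorm (Delta a - Delta b) <= 2 * rnorm (a - b).
Proof.
have -> : Delta a - Delta b = Delta (a - b).
  by rewrite addrC -scaleN1r -DeltaE scaleN1r addrC.
rewrite (le_trans (opnormD _ _)) // opnormN.
have := unital_star_rep_contractive (a - b) p1_rep.
have := unital_star_rep_contractive (a - b) p2_rep.
lra.
Qed.

(** It is used with T = id and T = [star], the two isometries in the definition of the subalgebra
    below. *)
Let TK_Delta_closed (E : set A) (T : A -> A) : (forall a b, rnorm (T a - T b) = rnorm (a - b)) ->
  (forall a, E a -> TK (Delta (T a))) -> forall a, closure E a -> TK (Delta (T a)).
Proof.
move=> Tiso ET a /closure_rnormP Ea; apply: closed_opnorm; first exact: spatial_tensor_closed.
move=> e e0; have [b Eb ab] := Ea (e / 2) (divr_gt0 e0 (ltr0Sn _ 1)).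
exists (Delta (T b)); first exact: ET.
rewrite (le_trans (Delta_lipschitz _ _)) // Tiso; lra.
Qed.

Lemma quasihom_of_generators : quasihom (@toeplitz R) (p1, p2).
Proof.
have [p1s p1one] := p1_rep; have [p2s p2one] := p2_rep.
(* Recording [star a] next to a makes D closed under [star] without appealing to closure of the
   ideal under adjoints. *)
pose D : set A := [set a | TK (Delta a) /\ TK (Delta (star a))].
have TKM a b : TK (Delta a) -> TK (Delta b) -> TK (Delta (a ** b)).
  move=> Da Db; rewrite DeltaM.
  apply: spatial_tensorD; first exact: toeplitz_compact_bcomp.
  by apply: spatial_tensorD; [case: (p2_mult b Da)|case: (p2_mult a Db)].
have Dsub : cstar_subalgebra D.
  have star0 : star 0 = 0 :> A by have := starB (0 : A) 0; rewrite !subrr.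
  split.
  - by rewrite /D /= star0 Delta0; split; exact: spatial_tensor0.
  - move=> c a b [Da Da'] [Db Db']; split.
      by rewrite DeltaE; apply: spatial_tensorD => //; exact: toeplitz_compactZ.
    rewrite starD starZ DeltaE; apply: spatial_tensorD => //.
    exact: toeplitz_compactZ.
  - move=> a b [Da Da'] [Db Db']; split; first exact: TKM.
    by rewrite starM; exact: TKM.
  - by move=> a [Da Da']; split; rewrite ?starK.
  - move=> a Da; split.
      by apply: (TK_Delta_closed (T := id)) Da => // b [].
    apply: (TK_Delta_closed (T := @star R A)) Da => [b c|b []//].
    by rewrite -starB rnorm_star.
have DA a : D a.
  have : [set: A] a by [].
  by rewrite -G_gen; apply: smallest_sub => // b Gb; exact: G_diff.
have Dp a : TK (p1 a - p2 a) by case: (DA a).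
split => //= a e Ke; rewrite -[p1 a](subrK (p2 a)) bcompDl bcompDr.
have [m1 m2] := p2_mult a Ke.
by split; apply: spatial_tensorD => //; exact: toeplitz_compact_bcomp.
Qed.

End QuasihomCriterion.

(** * Conjugated and amplified representations *)

Section Representations.
Context {R : realType} {A : cstarType R}.

Lemma unital_star_rep_conj (I J : choiceType) (f : A -> endop R I)
    (U : bop (l2 R I) (l2 R J)) Us : unitary_op U Us -> unital_star_rep f ->
  unital_star_rep (fun a => bcomp (bcomp U (f a)) Us).
Proof.
move=> [Uadj UsU UUs] [[fl fM fs] f1]; split; last by rewrite f1 bcomp1r.
split.
- by move=> c a b; rewrite fl bcompDr bcompZr bcompDl bcompZl.
- move=> a b; rewrite fM -[RHS]bcompA [bcomp Us _]bcompA [bcomp Us (bcomp _ _)]bcompA.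
  by rewrite UsU bcomp1l !bcompA.
- move=> a; rewrite -[bcomp (bcomp U (f (star a))) Us]bcompA.
  apply: adjoint_bcomp; first exact: adjoint_op_sym.
  by apply: adjoint_bcomp; first exact: fs.
Qed.

Lemma unital_star_rep_tens (I J : choiceType) (f : A -> endop R J) :
  unital_star_rep f -> unital_star_rep (fun a => tens (bid (l2 R I)) (f a)).
Proof.
move=> [[fl fM fs] f1]; split; last by rewrite f1 tens_bid.
split.
- by move=> c a b; rewrite fl tens_linearr.
- by move=> a b; rewrite fM bcomp_tens bcomp1l.
- by move=> a; apply: adjoint_tens; [exact: adjoint_bid|exact: fs].
Qed.

End Representations.

(** * The weights: uniform decay in (k, l) and convergence in m *)

Section Weights.
Context {R : realType} (q : R).
Hypothesis q_bound : -1 < q < 1.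

(** This is [gq] at a natural number, freed from rationals and [Num.floor]; [gq_nat] makes the
    link. *)
Definition gn (x : nat) : R := Num.sqrt (1 - q ^+ (2 * x)).

Let r : R := `|q|.
Let r0 : 0 <= r. Proof. exact: normr_ge0. Qed.
Let r1 : r < 1. Proof. by rewrite /r ltr_norml. Qed.

Let qr x : q ^+ (2 * x) = r ^+ (2 * x).
Proof. by rewrite !exprM real_normK ?num_real. Qed.

Let rX_le1 x : r ^+ x <= 1.
Proof. by rewrite exprn_ile1 // ltW. Qed.

Let rX_ge0 x : 0 <= r ^+ x.
Proof. exact: exprn_ge0. Qed.

Let rX_le x y : (x <= y)%N -> r ^+ y <= r ^+ x.
Proof. by move=> xy; apply: ler_wiXn2l => //; exact: ltW. Qed.

Lemma gn_ge0 x : 0 <= gn x. Proof. exact: sqrtr_ge0. Qed.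

Lemma gn_le1 x : gn x <= 1.
Proof. by rewrite /gn -[leRHS]sqrtr1 ler_sqrt // gerBl qr. Qed.

(** A number t in [0, 1] is at most its square root; here t = 1 - r^(2x). *)
Let gn_ge x y : (y <= 2 * x)%N -> 1 - r ^+ y <= gn x.
Proof.
move=> yx; apply: (@le_trans _ _ (1 - r ^+ (2 * x))); first by rewrite lerB ?rX_le.
rewrite /gn qr; set t := 1 - _; have t0 : 0 <= t by rewrite subr_ge0.
have t1 : t <= 1 by rewrite gerBl.
rewrite -[leLHS]ger0_norm // -sqrtr_sqr ler_sqrt // expr2.
by rewrite ler_piMl.
Qed.

Lemma gn0 : gn 0 = 0.
Proof. by rewrite /gn muln0 expr0 subrr sqrtr0. Qed.

Let kappa : R := 1 - r.
Let kappa0 : 0 < kappa. Proof. by rewrite subr_gt0. Qed.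
Let kappa1 : kappa <= 1. Proof. by rewrite gerBl. Qed.

Let kappa_gn x : (0 < x)%N -> kappa <= gn x.
Proof. by move=> x0; rewrite /kappa -[X in _ - X]expr1; apply: gn_ge; lia. Qed.

Definition den (x : nat) : R := gn x * gn x.+1.

Let den_ge x : (0 < x)%N -> kappa ^+ 2 <= den x.
Proof. by move=> x0; rewrite expr2 ler_pM ?kappa_gn ?ltW. Qed.

(** kappa^2 bounds [den z] from below for z > 0. The 2 is the loss in a product: two numbers in
    [1 - r^u, 1] have product in [1 - 2 r^u, 1]. *)
Let C : R := 2 / kappa ^+ 2.
Let C0 : 0 <= C. Proof. by rewrite divr_ge0 // exprn_ge0 // ltW. Qed.

Let ratio_le1 x y z : (0 < z)%N -> `|gn x * gn y / den z| <= C.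
Proof.
move=> z0; have dz := den_ge z0.
have k2 : 0 < kappa ^+ 2 by rewrite exprn_gt0.
have dz0 : 0 < den z by exact: lt_le_trans dz.
rewrite ger0_norm ?divr_ge0 ?mulr_ge0 ?gn_ge0 // ?(ltW dz0) //.
rewrite /C ler_pM ?mulr_ge0 ?gn_ge0 // ?invr_ge0 ?(ltW dz0) //.
  by rewrite (@le_trans _ _ 1) ?mulr_ile1 ?gn_ge0 ?gn_le1 ?ler1n.
by rewrite lef_pV2 ?posrE.
Qed.

Let gn_near1 x u : (u <= x)%N -> 1 - r ^+ u <= gn x <= 1.
Proof. by move=> ux; rewrite gn_le1 andbT gn_ge // mul2n -addnn (leq_trans ux) // leq_addr. Qed.

(** Numerator and denominator both lie in [1 - 2 r^u, 1], so they differ by at most 2 r^u. The index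
    z enters only through u <= z, which is what gives bounds uniform in m. *)
Let ratio_near1 (a b : R) z u : (0 < z)%N -> (u <= z)%N ->
  1 - r ^+ u <= a <= 1 -> 1 - r ^+ u <= b <= 1 ->
  `|a * b / den z - 1| <= C * r ^+ u.
Proof.
move=> z0 uz ua ub; have dz := den_ge z0.
have k2 : 0 < kappa ^+ 2 by rewrite exprn_gt0.
have dz0 : 0 < den z by exact: lt_le_trans dz.
have prod x y : 1 - r ^+ u <= x <= 1 -> 1 - r ^+ u <= y <= 1 ->
    1 - 2 * r ^+ u <= x * y /\ x * y <= 1.
  have := rX_ge0 u; have := rX_le1 u; move: (r ^+ u) => t t1 t0.
  by move=> /andP[? ?] /andP[? ?]; split; nra.
have [n1 n2] := prod _ _ ua ub.
have [d1 d2] : 1 - 2 * r ^+ u <= den z /\ den z <= 1.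
  by rewrite /den; apply: prod; apply: gn_near1; rewrite // leqW.
have -> : a * b / den z - 1 = (a * b - den z) / den z.
  by rewrite mulrBl divff // gt_eqF.
rewrite normrM normfV (gtr0_norm dz0) /C mulrAC ler_pM ?normr_ge0 ?invr_ge0 ?(ltW dz0) //.
  by rewrite ler_norml; apply/andP; split; lra.
by rewrite lef_pV2 ?posrE.
Qed.

(* The weights of the difference: [wA1], [wA2] for alpha (moves k -> k - 1 and
   m -> m + 1) and [wB1], [wB2], [wB3] for beta (l -> l - 1 with (m, k) fixed, both
   lowered, or both raised).  Division by [den 0 = 0] gives the convention that a_-
   and b_- vanish at n = 0. *)
Definition wA1 (p : nat * (nat * int)) : R := let: (m, (k, l)) := p in
  gn k * gn (k + `|l|) / den (m + k + `|l|) - gn k.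

Definition wA2 (p : nat * (nat * int)) : R := let: (m, (k, l)) := p in
  q ^+ (2 * k + `|l| + 1) * (gn (m + `|l| + 1) * gn (m + 1)) / den (m + k + `|l| + 1).

Definition wB1 (p : nat * (nat * int)) : R := let: (m, (k, l)) := p in
  (if l <= 0 then q ^+ k * (gn (m + `|l| + 1) * gn (k + `|l| + 1)) / den (m + k + `|l| + 1)
   else q ^+ k * (gn (k + `|l|) * gn (m + `|l|)) / den (m + k + `|l|)) - q ^+ k.

Definition wB2 (p : nat * (nat * int)) : R := let: (m, (k, l)) := p in
  if l <= 0 then - (q ^+ (k + `|l|) * (gn k * gn m) / den (m + k + `|l|)) else 0.

Definition wB3 (p : nat * (nat * int)) : R := let: (m, (k, l)) := p in
  if l <= 0 then 0 else
  - (q ^+ (k + `|l|) * (gn (m + 1) * gn (k + 1)) / den (m + k + `|l| + 1)).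

Definition decay_rate (p : nat * (nat * int)) : R := C * r ^+ (p.2.1 + `|p.2.2|).

Let normqX x : `|q ^+ x| = r ^+ x. Proof. by rewrite normrX. Qed.

(** For k = 0 both terms vanish with [gn] 0. Otherwise [gn] k factors out, and what remains is
    [ratio_near1] with u = k + |l| and second numerator factor 1. *)
Lemma wA1_le p : `|wA1 p| <= decay_rate p.
Proof.
case: p => m [[|k] l]; rewrite /wA1 /decay_rate /=.
  by rewrite gn0 !mul0r subrr normr0 mulr_ge0.
rewrite -mulrA -{2}[gn _]mulr1 -mulrBr normrM ger0_norm ?gn_ge0 //.
rewrite (le_trans (ler_piMl _ (gn_le1 _))) // -[gn (_ + _)]mulr1.
apply: ratio_near1; [lia|lia|by apply: gn_near1; lia|].
by rewrite lexx andbT gerBl.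
Qed.

Lemma wA2_le p : `|wA2 p| <= decay_rate p.
Proof.
case: p => m [k l]; rewrite /wA2 /decay_rate /= -mulrA normrM normqX.
rewrite [leRHS]mulrC ler_pM // ?ratio_le1 ?addn1 //.
by apply: rX_le; lia.
Qed.

(** q^k factors out, and every index left in the ratio is at least |l|, so the ratio is within C
    r^|l| of 1. *)
Lemma wB1_le p : `|wB1 p| <= decay_rate p.
Proof.
case: p => m [k l]; rewrite /wB1 /decay_rate /=.
case: ifP => l0; rewrite -mulrA -{2}[q ^+ k]mulr1 -mulrBr normrM normqX exprD mulrCA;
  rewrite ler_pM // ratio_near1 //; try apply: gn_near1; lia.
Qed.

Lemma wB2_le p : `|wB2 p| <= decay_rate p.
Proof.
case: p => m [k l]; rewrite /wB2 /decay_rate /=.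
case: ifP => l0; last by rewrite normr0 mulr_ge0.
case: k => [|k]; first by rewrite gn0 mul0r mulr0 mul0r oppr0 normr0 mulr_ge0.
by rewrite -mulrA normrN normrM normqX [leRHS]mulrC ler_pM // ratio_le1 //; lia.
Qed.

Lemma wB3_le p : `|wB3 p| <= decay_rate p.
Proof.
case: p => m [k l]; rewrite /wB3 /decay_rate /=.
case: ifP => l0; first by rewrite normr0 mulr_ge0.
by rewrite -mulrA normrN normrM normqX [leRHS]mulrC ler_pM // ratio_le1 //; lia.
Qed.

Lemma decay_rate_le p : decay_rate p <= C.
Proof. by rewrite /decay_rate ler_piMr. Qed.

Lemma decay_rate_small e : 0 < e -> exists s : seq (nat * int),
  forall m j, j \notin s -> decay_rate (m, j) <= e.
Proof.
move=> e0; have e1 : 0 < e / (C + 1) by rewrite divr_gt0 // ltr_wpDl.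
have [K _ HK] : \forall n \near \oo, `|0 - r ^+ n| <= e / (C + 1).
  have /cvgrPdist_le : r ^+ n @[n --> \oo] --> (0 : R).
    by apply: cvg_expr; rewrite ger0_norm.
  by apply.
(* This box contains all (k, l) with k + |l| < K; as [Negz n] is -(n + 1), it also reaches l =
   -K. *)
exists [seq (k, l) | k <- iota 0 K, l <- map Posz (iota 0 K) ++ map Negz (iota 0 K)].
move=> m [k l] kl; rewrite /decay_rate /=.
have Kkl : (K <= k + `|l|)%N.
  rewrite leqNgt; apply: contra kl => kl.
  apply/allpairsP; exists (k, l); split => //=; first by rewrite mem_iota; lia.
  rewrite mem_cat; case: l kl => l kl; apply/orP; [left|right].
    by apply/mapP; exists l => //; rewrite mem_iota; lia.
  by apply/mapP; exists l => //; rewrite mem_iota; lia.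
have := HK _ Kkl; rewrite sub0r normrN ger0_norm // ler_pdivlMr ?ltr_wpDl //.
have := rX_ge0 (k + `|l|); lra.
Qed.

Let gn_cvg c : gn (n + c) @[n --> \oo] --> (1 : R).
Proof.
have r2 : `|q ^+ 2| < 1 by rewrite normrX expr_lt1.
have H : (1 - q ^+ (2 * (n + c))) @[n --> \oo] --> (1 - 0 : R).
  apply: cvgB; first exact: cvg_cst.
  under eq_fun do rewrite exprM.
  by have := cvg_expr r2; rewrite -(cvg_shiftn c); apply.
rewrite subr0 in H; rewrite -sqrtr1.
exact: (@continuous_cvg _ _ _ \oo _ (fun n => 1 - q ^+ (2 * (n + c))) Num.sqrt _
  (@sqrt_continuous R 1) H).
Qed.

Let ratio_cvg (c0 : R) (f1 f2 : nat -> R) (N : nat -> nat) c :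
  cvgn f1 -> cvgn f2 -> (forall m, N m = m + c)%N ->
  cvgn (fun m => c0 * (f1 m * f2 m) / den (N m)).
Proof.
move=> f1c f2c NE.
have H : (den (N m))^-1 @[m --> \oo] --> ((1 * 1)^-1 : R).
  apply: cvgV; first by rewrite mulr1 oner_neq0.
  apply: cvgM.
    by under eq_fun do rewrite NE; exact: gn_cvg.
  by under eq_fun do rewrite NE -addnS; exact: gn_cvg.
apply: is_cvgM; last by apply/cvg_ex; eexists; exact: H.
by apply: is_cvgM; [exact: is_cvg_cst|exact: is_cvgM].
Qed.

Let gn_is_cvg f c : (forall m, f m = m + c)%N -> cvgn (fun m => gn (f m)).
Proof. by move=> fE; under eq_fun do rewrite fE; apply/cvg_ex; eexists; exact: gn_cvg. Qed.

Lemma wA1_cvg j : cvgn (fun m => wA1 (m, j)).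
Proof.
case: j => k l; rewrite /wA1; apply: is_cvgB; last exact: is_cvg_cst.
have := @ratio_cvg 1 (fun=> gn k) (fun=> gn (k + `|l|)) (fun m => m + k + `|l|)%N
  (k + `|l|) (is_cvg_cst _) (is_cvg_cst _) (fun m => esym (addnA _ _ _)).
under eq_fun do rewrite mul1r; apply.
Qed.

Lemma wA2_cvg j : cvgn (fun m => wA2 (m, j)).
Proof.
case: j => k l; rewrite /wA2.
apply: (@ratio_cvg (q ^+ (2 * k + `|l| + 1)) (fun m => gn (m + `|l| + 1))
  (fun m => gn (m + 1)) (fun m => m + k + `|l| + 1)%N (k + `|l| + 1)).
- by apply: (@gn_is_cvg _ (`|l| + 1)) => m; rewrite addnA.
- exact: (@gn_is_cvg _ 1).
- by move=> m; rewrite !addnA.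
Qed.

Lemma wB1_cvg j : cvgn (fun m => wB1 (m, j)).
Proof.
case: j => k l; rewrite /wB1; apply: is_cvgB; last exact: is_cvg_cst.
case: (l <= 0).
  apply: (@ratio_cvg (q ^+ k) (fun m => gn (m + `|l| + 1)) (fun=> gn (k + `|l| + 1))
    (fun m => m + k + `|l| + 1)%N (k + `|l| + 1)).
  - by apply: (@gn_is_cvg _ (`|l| + 1)) => m; rewrite addnA.
  - exact: is_cvg_cst.
  - by move=> m; rewrite !addnA.
apply: (@ratio_cvg (q ^+ k) (fun=> gn (k + `|l|)) (fun m => gn (m + `|l|))
  (fun m => m + k + `|l|)%N (k + `|l|)).
- exact: is_cvg_cst.
- exact: (@gn_is_cvg _ `|l|).
- by move=> m; rewrite addnA.
Qed.

Lemma wB2_cvg j : cvgn (fun m => wB2 (m, j)).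
Proof.
case: j => k l; rewrite /wB2; case: (l <= 0); last exact: is_cvg_cst.
apply: is_cvgN; apply: (@ratio_cvg (q ^+ (k + `|l|)) (fun=> gn k) gn
  (fun m => m + k + `|l|)%N (k + `|l|)).
- exact: is_cvg_cst.
- by apply: (@gn_is_cvg _ 0) => m; rewrite addn0.
- by move=> m; rewrite addnA.
Qed.

Lemma wB3_cvg j : cvgn (fun m => wB3 (m, j)).
Proof.
case: j => k l; rewrite /wB3; case: (l <= 0); first exact: is_cvg_cst.
apply: is_cvgN; apply: (@ratio_cvg (q ^+ (k + `|l|)) (fun m => gn (m + 1))
  (fun=> gn (k + 1)) (fun m => m + k + `|l| + 1)%N (k + `|l| + 1)).
- exact: (@gn_is_cvg _ 1).
- exact: is_cvg_cst.
- by move=> m; rewrite !addnA.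
Qed.

End Weights.

(** * The coordinates (m, k, l) on Gamma and the unitary *)

Section GammaCoordinates.
Context {R : realType}.

Definition pos_part (l : int) : nat := if l is Posz n then n else 0%N.
Definition neg_part (l : int) : nat := if l is Negz n then n.+1 else 0%N.

Lemma absz_parts l : `|l|%N = (neg_part l + pos_part l)%N.
Proof. by case: l => n; rewrite ?addn0. Qed.

(* The index (n, i, j) with 2n = N, n + i = a and n + j = b. *)
Definition half_triple (N a b : nat) : rat * rat * rat :=
  (N%:R / 2, a%:R - N%:R / 2, b%:R - N%:R / 2).

Lemma in_Gamma_half_triple N a b : (a <= N)%N -> (b <= N)%N ->
  in_Gamma (half_triple N a b).
Proof.
move=> aN bN; rewrite /in_Gamma /half_triple.
have E2 : 2 * (N%:R / 2) = N%:R :> rat by field.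
have Ed (c : nat) : N%:R / 2 + (c%:R - N%:R / 2) = c%:R :> rat by field.
have Es (c : nat) : (c <= N)%N -> N%:R / 2 - (c%:R - N%:R / 2) = (N - c)%:R :> rat.
  by move=> cN; rewrite natrB //; field.
by rewrite E2 !Ed !Es // !Num.Theory.natr_nat.
Qed.

Lemma half_triple_inj N a b N' a' b' : half_triple N a b = half_triple N' a' b' ->
  [/\ N = N', a = a' & b = b'].
Proof.
move=> [/(congr1 (fun x => x * 2))]; rewrite !divfK // => /eqP.
rewrite eqr_nat => /eqP <- /addIr/eqP; rewrite eqr_nat => /eqP <- /addIr/eqP.
by rewrite eqr_nat => /eqP <-.
Qed.

Lemma half_tripleP x : in_Gamma x -> exists N a b,
  [/\ (a <= N)%N, (b <= N)%N & x = half_triple N a b].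
Proof.
move: x => [[n i] j] /and5P[/natrP[N nN] /natrP[a na] /natrP[c nc] /natrP[b nb] /natrP[d nd]].
have nE : n = N%:R / 2 by rewrite -nN; field.
have Nac : (N = a + c)%N by apply/eqP; rewrite -(@eqr_nat rat) natrD -nN -na -nc; apply/eqP; ring.
have Nbd : (N = b + d)%N by apply/eqP; rewrite -(@eqr_nat rat) natrD -nN -nb -nd; apply/eqP; ring.
exists N, a, b; split; [by rewrite Nac leq_addr|by rewrite Nbd leq_addr|].
by rewrite /half_triple -nE -na -nb; congr (_, _, _); ring.
Qed.

Definition triple (p : nat * (nat * int)) : rat * rat * rat := let: (m, (k, l)) := p in
  half_triple (m + k + `|l|) (k + neg_part l) (k + pos_part l).

Lemma in_Gamma_triple p : in_Gamma (triple p).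
Proof.
case: p => m [k l]; apply: in_Gamma_half_triple; rewrite absz_parts; lia.
Qed.

Definition to_Gamma p : Gamma := exist _ (triple p) (in_Gamma_triple p).

Lemma to_Gamma_inj : injective to_Gamma.
Proof.
move=> [m [k l]] [m' [k' l']] /(congr1 val) /half_triple_inj[].
rewrite !absz_parts; case: l l' => n [] n' /=; try lia.
  by move=> H1 H2 H3; congr (_, (_, _)); lia.
by move=> H1 H2 H3; congr (_, (_, _)); lia.
Qed.

Lemma to_Gamma_surj (x : Gamma) : exists p, to_Gamma p = x.
Proof.
case: x => x xG; have [N [a [b [aN bN xE]]]] := half_tripleP xG.
(* Since {a, b} = {k, k + |l|}, the minimum is k, the maximum is k + |l|, and m is what is left of
   N. *)
exists ((N - maxn a b)%N, (minn a b, b%:Z - a%:Z)); apply: val_inj => /=.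
rewrite xE; have [ab|/ltnW ba] := leqP a b.
  have -> : b%:Z - a%:Z = Posz (b - a) by lia.
  by congr half_triple => /=; lia.
have [->|ab] := eqVneq a b.
  by rewrite subrr /=; congr half_triple => /=; lia.
have -> : b%:Z - a%:Z = Negz (a - b).-1 by lia.
by congr half_triple => /=; lia.
Qed.

Definition of_Gamma (x : Gamma) : nat * (nat * int) := projT1 (cid (to_Gamma_surj x)).

Lemma of_GammaK : cancel of_Gamma to_Gamma.
Proof. by move=> x; rewrite /of_Gamma; case: cid. Qed.

Lemma to_GammaK : cancel to_Gamma of_Gamma.
Proof. by move=> p; apply: to_Gamma_inj; rewrite of_GammaK. Qed.

Lemma of_Gamma_inj : injective of_Gamma.
Proof. exact: can_inj of_GammaK. Qed.

Lemma eG_triple p n i j : (n, i, j) = triple p -> eG R n i j = delta (to_Gamma p).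
Proof. by move=> nij; rewrite /eG nij (valK (to_Gamma p)). Qed.

(** A step l -> l - 1 flips this sign exactly when l <= 0, where the dominant term of beta is b_+
    with its minus sign; from l > 0 the dominant term is b_- and the sign stays 1. *)
Definition gsign (p : nat * (nat * int)) : R := (-1) ^+ neg_part p.2.2.

Lemma gsign_le1 p : `|gsign p| <= 1.
Proof. by rewrite normrX normrN1 expr1n. Qed.

Lemma gsign2 p : gsign p * gsign p = 1.
Proof. by rewrite -expr2 /gsign sqrr_sign. Qed.

Definition U_Gamma : bop (l2 R Gamma) (l2 R (nat * (nat * int))%type) :=
  bcomp (diag gsign_le1) (reindex_op R to_Gamma_inj).
Definition Us_Gamma : bop (l2 R (nat * (nat * int))%type) (l2 R Gamma) :=
  bcomp (reindex_op R of_Gamma_inj) (diag gsign_le1).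

Lemma reindex_to_Gamma p :
  reindex_op R to_Gamma_inj (delta (to_Gamma p)) = delta p.
Proof. by apply: l2P => p'; rewrite /= (inj_eq to_Gamma_inj). Qed.

Lemma reindex_of_Gamma p :
  reindex_op R of_Gamma_inj (delta p) = delta (to_Gamma p).
Proof. by apply: l2P => x; rewrite /= (can2_eq of_GammaK to_GammaK). Qed.

Lemma U_GammaE p : U_Gamma (delta (to_Gamma p)) = (gsign p)%:C%C *: delta p.
Proof. by rewrite /U_Gamma bcompE reindex_to_Gamma diag_delta. Qed.

Lemma Us_GammaE p : Us_Gamma (delta p) = (gsign p)%:C%C *: delta (to_Gamma p).
Proof. by rewrite /Us_Gamma bcompE diag_delta linearZ -reindex_of_Gamma. Qed.

Lemma U_Gamma_unitary : unitary_op U_Gamma Us_Gamma.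
Proof.
have gg p : (gsign p)%:C%C * (gsign p)%:C%C = 1 :> R[i] by rewrite -rmorphM gsign2.
split.
- apply: adjoint_bcomp; last exact: adjoint_diag.
  by apply: adjoint_reindex => p; exact: reindex_of_Gamma.
- apply: bop_delta_ext => x; rewrite -(of_GammaK x) bcompE U_GammaE.
  have -> : forall c y, Us_Gamma (c *: y) = c *: Us_Gamma y by move=> c y; rewrite linearZ.
  by rewrite Us_GammaE scalerA gg scale1r.
- apply: bop_delta_ext => p; rewrite bcompE Us_GammaE.
  have -> : forall c y, U_Gamma (c *: y) = c *: U_Gamma y by move=> c y; rewrite linearZ.
  by rewrite U_GammaE scalerA gg scale1r.
Qed.

End GammaCoordinates.

(** * The coefficients of [lambda] in integral parameters *)

Section LambdaCoefficients.
Context {R : realType} (q : R).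

Lemma qpow_nat (x : rat) (m : nat) : x = m%:R -> qpow q x = q ^+ m.
Proof. by move=> ->; rewrite /qpow pmulrn intrKfloor. Qed.

Lemma gq_nat (x : rat) (m : nat) : x = m%:R -> gq q x = gn q m.
Proof. by move=> ->; rewrite /gq (@qpow_nat _ (2 * m)%N) // natrM. Qed.

Section Half.
Variables (N a b : nat).
Hypotheses (aN : (a <= N)%N) (bN : (b <= N)%N).
Let n : rat := N%:R / 2.
Let i : rat := a%:R - n.
Let j : rat := b%:R - n.

Lemma a_plus_half : a_plus q n i j =
  q ^+ (a + b + 1) * (gn q (N - b + 1) * gn q (N - a + 1)) / den q (N + 1).
Proof.
rewrite /a_plus /den (@qpow_nat _ (a + b + 1)) ?natrD /i /j /n; last by field.
rewrite (@gq_nat _ (N - b + 1)) ?natrD ?natrB //; last by field.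
rewrite (@gq_nat _ (N - a + 1)) ?natrD ?natrB //; last by field.
rewrite (@gq_nat _ (N + 1)) ?natrD; last by field.
by rewrite (@gq_nat _ (N + 1).+1) // -addn1 !natrD; field.
Qed.

Lemma b_plus_half : b_plus q n i j =
  - (q ^+ b * (gn q (N - b + 1) * gn q (a + 1)) / den q (N + 1)).
Proof.
rewrite /b_plus /den (@qpow_nat _ b) /i /j /n; last by field.
rewrite (@gq_nat _ (N - b + 1)) ?natrD ?natrB //; last by field.
rewrite (@gq_nat _ (a + 1)) ?natrD; last by field.
rewrite (@gq_nat _ (N + 1)) ?natrD; last by field.
rewrite (@gq_nat _ (N + 1).+1) ?mulNr //; by rewrite -addn1 !natrD; field.
Qed.

Lemma a_minus_half : a_minus q n i j = gn q b * gn q a / den q N.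
Proof.
(* When N = 0 also b = 0, and the factor [gn] 0 reproduces the convention a_- = 0. *)
rewrite /a_minus /den /n mulf_eq0 invr_eq0 pnatr_eq0 orbF; case: eqP => [N0|_].
  by move: bN; rewrite N0 leqn0 => /eqP ->; rewrite gn0 !mul0r.
rewrite /i /j /n (@gq_nat _ b); last by field.
rewrite (@gq_nat _ a); last by field.
rewrite (@gq_nat _ N); last by field.
by rewrite (@gq_nat _ N.+1) // -addn1 natrD; field.
Qed.

Lemma b_minus_half : b_minus q n i j = q ^+ a * (gn q b * gn q (N - a)) / den q N.
Proof.
rewrite /b_minus /den /n mulf_eq0 invr_eq0 pnatr_eq0 orbF; case: eqP => [N0|_].
  by move: bN; rewrite N0 leqn0 => /eqP ->; rewrite gn0 !mul0r mulr0 mul0r.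
rewrite /i /j /n (@qpow_nat _ a); last by field.
rewrite (@gq_nat _ b); last by field.
rewrite (@gq_nat _ (N - a)) ?natrB //; last by field.
rewrite (@gq_nat _ N); last by field.
by rewrite (@gq_nat _ N.+1) // -addn1 natrD; field.
Qed.

End Half.

End LambdaCoefficients.

(** * Weighted shifts in the ideal *)

Section WeightedShifts.
Context {R : realType} {J : choiceType}.
Local Notation TK := (spatial_tensor (@toeplitz R) (@compact_op R J)).

(** The adjoint is carried along because the criterion on generators asks for the difference at both
    a and [star a]. *)
Definition adjointable_in_TK (X : endop R (nat * J)%type) :=
  exists2 X', adjoint_op X X' & TK X /\ TK X'.

Lemma adjointable_in_TKD X Y : adjointable_in_TK X -> adjointable_in_TK Y ->
  adjointable_in_TK (X + Y).
Proof.
move=> [X' XX' [KX KX']] [Y' YY' [KY KY']]; exists (X' + Y').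
  exact: adjoint_opD.
by split; exact: spatial_tensorD.
Qed.

Lemma adjointable_in_TK_weighted S S' T T' (w : nat * J -> R) (M : R) (wM : forall p, `|w p| <= M) :
  adjoint_op S S' -> adjoint_op T T' -> toeplitz S -> toeplitz S' ->
  (forall j, cvgn (fun m => w (m, j))) ->
  (forall e : R, 0 < e -> exists s : seq J,
     forall m j, j \notin s -> `|w (m, j)| <= e) ->
  adjointable_in_TK (bcomp (tens S T) (diag wM)).
Proof.
move=> SS' TT' tS tS' wc ws; have Kw := toeplitz_compact_diag (wM := wM) wc ws.
exists (bcomp (diag wM) (tens S' T')).
  by apply: adjoint_bcomp; [exact: adjoint_diag|exact: adjoint_tens].
have [KS _] := toeplitz_compact_multiplier T tS Kw.
by have [_ KS'] := toeplitz_compact_multiplier T' tS' Kw.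
Qed.

End WeightedShifts.

(** * Alpha and beta under [lambda] in the new coordinates *)

Section Lambda.
Context {R : realType} (q : R) (A : cstarType R) (alpha beta : A).
Variables (lambda : A -> endop R Gamma).
Hypothesis lambda_q : is_lambda_q q alpha beta lambda.

Lemma eG_coord (n i j : rat) m k l : 2 * n = (m + k + `|l|)%N%:R ->
  n + i = (k + neg_part l)%N%:R -> n + j = (k + pos_part l)%N%:R ->
  eG R n i j = delta (to_Gamma (m, (k, l))).
Proof.
move=> nE iE jE; apply: eG_triple; rewrite /triple /half_triple -nE -iE -jE.
by congr (_, _, _); field.
Qed.

Lemma neg_part_le0 l : l <= 0 -> [/\ pos_part l = 0, `|l| = neg_part l, pos_part (l - 1) = 0,
  neg_part (l - 1) = (neg_part l).+1 & `|l - 1| = (neg_part l).+1]%N.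
Proof.
case: l => [[|n]|n] // _.
by rewrite (_ : Negz n - 1 = Negz n.+1) // !NegzE -opprD -PoszD addn1.
Qed.

Lemma pos_part_gt0 l : (l <= 0) = false -> [/\ neg_part l = 0, `|l| = (pos_part (l - 1)).+1,
  neg_part (l - 1) = 0, pos_part l = (pos_part (l - 1)).+1 & `|l - 1| = pos_part (l - 1)]%N.
Proof.
case: l => [[|n]|n] // _.
by rewrite (_ : Posz n.+1 - 1 = Posz n) // -addn1 PoszD addrK.
Qed.

Section Coordinates.
Variables (m k : nat) (l : int).
Let N := (m + k + `|l|)%N.
Let a := (k + neg_part l)%N.
Let b := (k + pos_part l)%N.

Let aN : (a <= N)%N. Proof. by rewrite /a /N absz_parts; lia. Qed.
Let bN : (b <= N)%N. Proof. by rewrite /b /N absz_parts; lia. Qed.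

(** The a_- coefficient is split as [wA1] plus [gn] k so that the second summand cancels against I
    (x) pi(alpha). *)
Lemma lambda_alphaE : lambda alpha (delta (to_Gamma (m, (k, l)))) =
  (wA2 q (m, (k, l)))%:C%C *: delta (to_Gamma (m.+1, (k, l))) +
  (wA1 q (m, (k, l)) + gn q k)%:C%C *:
    (if k is k'.+1 then delta (to_Gamma (m, (k', l))) else 0).
Proof.
have [_ + _] := lambda_q; have G := in_Gamma_half_triple aN bN.
move=> /(_ _ _ _ G); rewrite (eG_triple (p := (m, (k, l)))) // => ->.
rewrite a_plus_half // a_minus_half // /wA1 /wA2 subrK; congr (_ *: _ + _).
- congr (_%:C%C); rewrite /a /b /N.
  case: (l) => n /=; rewrite ?addn0; congr (q ^+ _ * _ / _); try lia.
    by rewrite mulrC; congr (gn q _ * gn q _); lia.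
  by congr (gn q _ * gn q _); lia.
- by apply: eG_coord; rewrite /a /b /N -?(addn1 m) !natrD; field.
- rewrite /a /b /N; case: k => [|k'].
    (* At k = 0 the target index leaves Gamma; one of the two parts of l is 0, so a factor [gn] 0
       removes the term. *)
    have -> : gn q (0 + pos_part l) * gn q (0 + neg_part l) = 0.
      by case: (l) => n; rewrite /= ?gn0 ?mulr0 ?mul0r.
    by rewrite gn0 !mul0r !scale0r.
  congr (_%:C%C *: _).
    by congr (_ / _); case: (l) => n /=; rewrite ?addn0 // mulrC.
  by apply: eG_coord; rewrite -(addn1 k') !natrD; field.
Qed.

(** For l <= 0 the smaller of n+i and n+j is n+j = k. Hence b_+, which raises n+i only, keeps m and
    k, while b_- lowers both. *)
Lemma lambda_beta_le0 : l <= 0 -> lambda beta (delta (to_Gamma (m, (k, l)))) =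
  - ((wB1 q (m, (k, l)) + q ^+ k)%:C%C *: delta (to_Gamma (m, (k, l - 1))) +
     (wB2 q (m, (k, l)))%:C%C *:
      (if m is m'.+1 then if k is k'.+1 then delta (to_Gamma (m', (k', l - 1))) else 0 else 0)).
Proof.
move=> l0; have [_ _] := lambda_q; have G := in_Gamma_half_triple aN bN.
move=> /(_ _ _ _ G); rewrite (eG_triple (p := (m, (k, l)))) // => ->.
rewrite b_plus_half // b_minus_half // /wB1 /wB2 l0 subrK opprD rmorphN scaleNr.
have [pl lE pl' nl' lE'] := neg_part_le0 l0.
have aE : a = (k + `|l|)%N by rewrite /a -lE.
have bE : b = k by rewrite /b pl addn0.
have NbE : (N - b = m + `|l|)%N by rewrite bE /N; lia.
have NaE : (N - a = m)%N by rewrite aE /N; lia.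
rewrite NbE NaE aE bE; congr (- (_ *: _) + _).
  by apply: eG_coord; rewrite ?lE' ?nl' ?pl' -?lE -?(addn1 `|l|) !natrD; field.
(* If m = 0 or k = 0, a factor [gn] 0 kills the b_- term, whose target would lie outside Gamma. *)
rewrite rmorphN scaleNr opprK /N; case: m k => [|m'] [|k'];
  rewrite ?gn0 ?(mulr0, mul0r) ?scale0r ?scaler0 //.
congr (_ *: _); apply: eG_coord;
  by rewrite ?lE' ?nl' ?pl' -?lE -?(addn1 `|l|) -?(addn1 m') -?(addn1 k') !natrD; field.
Qed.

(** For l > 0 the roles are exchanged: b_- lowers the larger number n+j and keeps m and k, while b_+
    raises n+i = k and m with it. *)
Lemma lambda_beta_gt0 : (l <= 0) = false -> lambda beta (delta (to_Gamma (m, (k, l)))) =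
  (wB1 q (m, (k, l)) + q ^+ k)%:C%C *: delta (to_Gamma (m, (k, l - 1))) +
  (wB3 q (m, (k, l)))%:C%C *: delta (to_Gamma (m.+1, (k.+1, l - 1))).
Proof.
move=> l0; have [_ _] := lambda_q; have G := in_Gamma_half_triple aN bN.
move=> /(_ _ _ _ G); rewrite (eG_triple (p := (m, (k, l)))) // => ->.
rewrite b_plus_half // b_minus_half // /wB1 /wB3 l0 subrK addrC.
have [nl lE nl' pl lE'] := pos_part_gt0 l0.
have aE : a = k by rewrite /a nl addn0.
have bE : b = (k + `|l|)%N by rewrite /b pl lE.
have NbE : (N - b = m)%N by rewrite bE /N; lia.
have NaE : (N - a = m + `|l|)%N by rewrite aE /N; lia.
rewrite NbE NaE aE bE /N; congr (_ *: _ + _ *: _); apply: eG_coord;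
  by rewrite ?lE' ?nl' ?pl ?lE -?(addn1 (pos_part (l - 1))) -?(addn1 m) -?(addn1 k) !natrD; field.
Qed.

End Coordinates.

End Lambda.

(** * The differences at alpha and beta as sums of weighted shifts *)

Section Difference.
Context {R : realType} (q : R) (A : cstarType R) (alpha beta : A).
Hypothesis q_bound : -1 < q < 1.
Variables (lambda : A -> endop R Gamma) (rho : A -> endop R (nat * int)%type).
Hypothesis lambda_q : is_lambda_q q alpha beta lambda.
Hypothesis rho_q : is_pi_q q alpha beta rho.
Local Notation TK := (spatial_tensor (@toeplitz R) (@compact_op R (nat * int)%type)).

Let p1 a := bcomp (bcomp U_Gamma (lambda a)) Us_Gamma.
Let p2 a := tens (bid (l2 R nat)) (rho a).

Let p1_delta a p : p1 a (delta p) = (gsign p)%:C%C *: U_Gamma (lambda a (delta (to_Gamma p))).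
Proof.
have E : p1 a (delta p) = U_Gamma (lambda a (Us_Gamma (delta p))) by [].
have UZ (c : R[i]) x : U_Gamma (c *: x) = c *: U_Gamma x by rewrite linearZ.
have LZ (c : R[i]) x : lambda a (c *: x) = c *: lambda a x by rewrite linearZ.
by rewrite E Us_GammaE LZ UZ.
Qed.

Let U_lin (c d : R[i]) x y :
  U_Gamma (c *: x + d *: y) = c *: U_Gamma x + d *: U_Gamma y :> l2 R _.
Proof. by rewrite linearD !linearZ. Qed.

Let U_opp x : U_Gamma (- x) = - U_Gamma x :> l2 R _.
Proof. by rewrite linearN. Qed.

Lemma weighted_delta (S : endop R nat) (T : endop R nat) (V : endop R int)
    (w : nat * (nat * int) -> R) (M : R) (wM : forall p, `|w p| <= M) m k l :
  bcomp (tens S (tens T V)) (diag wM) (delta (m, (k, l))) =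
  (w (m, (k, l)))%:C%C *: vtens (S (delta m)) (vtens (T (delta k)) (V (delta l))).
Proof.
have TZ (c : R[i]) x : tens S (tens T V) (c *: x) = c *: tens S (tens T V) x.
  by rewrite linearZ.
by rewrite bcompE diag_delta TZ !delta_pair !tensE.
Qed.

Let weight_bound (w : nat * (nat * int) -> R) :
  (forall p, `|w p| <= decay_rate q p) ->
  forall p, `|w p| <= 2 / (1 - `|q|) ^+ 2.
Proof. by move=> wd p; apply: le_trans (wd p) _; exact: decay_rate_le. Qed.

Let weighted_in_TK S S' T T' V V' (w : nat * (nat * int) -> R) (M : R)
    (wM : forall p, `|w p| <= M) :
  (forall p, `|w p| <= decay_rate q p) -> (forall j, cvgn (fun m => w (m, j))) ->
  adjoint_op S S' -> adjoint_op T T' -> adjoint_op V V' -> toeplitz S -> toeplitz S' ->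
  adjointable_in_TK (bcomp (tens S (tens T V)) (diag wM)).
Proof.
move=> wd wc SS' TT' VV' tS tS'.
apply: (adjointable_in_TK_weighted wM SS' (adjoint_tens TT' VV') tS tS' wc) => e e0.
have [s Hs] := decay_rate_small q_bound e0; exists s => m j js.
exact: le_trans (wd _) (Hs m j js).
Qed.

Let gg p (c : R[i]) : (gsign p)%:C%C * c * (gsign p)%:C%C = c.
Proof. by rewrite mulrAC mulrC -rmorphM gsign2 mulr1. Qed.

Let tbid := @toeplitz_bid R.
Let tush := @toeplitz_ushift R.
Let tlsh := @toeplitz_lshift R.
Let abid (I : choiceType) := @adjoint_bid R I.
Let alsh := @adjoint_lshiftN R.
Let aush := adjoint_op_sym alsh.
Let alshZ := @adjoint_lshiftZ R.

Lemma alpha_difference_in_TK : adjointable_in_TK (p1 alpha - p2 alpha).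
Proof.
have w1 := weight_bound (wA1_le q_bound); have w2 := weight_bound (wA2_le q_bound).
have -> : p1 alpha - p2 alpha =
    bcomp (tens (bid _) (tens (lshiftN R) (bid _))) (diag w1) +
    bcomp (tens (ushift R) (tens (bid _) (bid _))) (diag w2).
  apply: bop_delta_ext => -[m [k l]].
  rewrite bopBE bopDE !weighted_delta p1_delta (lambda_alphaE lambda_q) U_lin U_GammaE.
  rewrite [delta (m, (k, l))]delta_pair delta_pair /p2 tensE; have [_ -> _] := rho_q.
  rewrite -/(gn q k) vtensZr ushiftE lshiftNE !(delta_pair m.+1, delta_pair k).
  (* alpha preserves l, so the signs at source and target coincide and cancel. *)
  rewrite scalerDr !scalerA -[gsign (m.+1, _)]/(gsign (m, (k, l))) gg.
  case: k => [|k].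
    by rewrite linear0 gn0 vtens0l !vtens0r !scaler0 subr0 addr0 add0r.
  rewrite U_GammaE -[gsign (m, (k, l))]/(gsign (m, (k.+1, l))) scalerA gg.
  by rewrite !delta_pair rmorphD scalerDl addrA addrK addrC.
apply: adjointable_in_TKD; apply: weighted_in_TK.
- exact: wA1_le.
- exact: wA1_cvg.
- exact: abid.
- exact: alsh.
- exact: abid.
- exact: tbid.
- exact: tbid.
- exact: wA2_le.
- exact: wA2_cvg.
- exact: aush.
- exact: abid.
- exact: abid.
- exact: tush.
- exact: tlsh.
Qed.

Lemma beta_difference_in_TK : adjointable_in_TK (p1 beta - p2 beta).
Proof.
have w1 := weight_bound (wB1_le q_bound); have w2 := weight_bound (wB2_le q_bound).
have w3 := weight_bound (wB3_le q_bound).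
have -> : p1 beta - p2 beta =
    bcomp (tens (bid _) (tens (bid _) (lshiftZ R))) (diag w1) +
    (bcomp (tens (lshiftN R) (tens (lshiftN R) (lshiftZ R))) (diag w2) +
     bcomp (tens (ushift R) (tens (ushift R) (lshiftZ R))) (diag w3)).
  apply: bop_delta_ext => -[m [k l]].
  rewrite bopBE !bopDE !weighted_delta p1_delta.
  rewrite [X in _ - _ X]delta_pair delta_pair /p2 tensE; have [_ _ ->] := rho_q.
  rewrite vtensZr !ushiftE lshiftZE !lshiftNE.
  case l0 : (l <= 0).
    have [_ _ _ nl _] := neg_part_le0 l0.
    (* This change of sign cancels the overall minus in [lambda_beta_le0]. *)
    have gN : gsign (R := R) (m, (k, l)) = - gsign (m, (k, l - 1)).
      by rewrite /gsign /= nl exprS mulN1r opprK.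
    rewrite (lambda_beta_le0 lambda_q) // U_opp U_lin U_GammaE gN.
    have -> : wB3 q (m, (k, l)) = 0 by rewrite /wB3 l0.
    rewrite scale0r addr0 rmorphN scaleNr scalerN opprK scalerDr !scalerA gg.
    rewrite rmorphD scalerDl -!delta_pair addrAC addrK; congr (_ + _).
    case: m gN => [|m] gN.
      by rewrite linear0 vtens0l !scaler0.
    case: k gN => [|k] gN.
      by rewrite linear0 vtens0l vtens0r !scaler0.
    rewrite U_GammaE -[gsign (m, _)]/(gsign (m.+1, (k.+1, l - 1))) scalerA gg.
    by rewrite -!delta_pair.
  have [nl _ nl' _ _] := pos_part_gt0 l0.
  have gE : gsign (R := R) (m, (k, l)) = gsign (m, (k, l - 1)).
    by rewrite /gsign /= nl nl'.
  rewrite (lambda_beta_gt0 lambda_q) // U_lin !U_GammaE gE.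
  have -> : wB2 q (m, (k, l)) = 0 by rewrite /wB2 l0.
  rewrite scale0r add0r scalerDr !scalerA gg.
  rewrite -[gsign (m.+1, _)]/(gsign (m, (k, l - 1))) gg.
  by rewrite rmorphD scalerDl -!delta_pair addrAC addrK.
apply: adjointable_in_TKD; last apply: adjointable_in_TKD; apply: weighted_in_TK.
- exact: wB1_le.
- exact: wB1_cvg.
- exact: abid.
- exact: abid.
- exact: alshZ.
- exact: tbid.
- exact: tbid.
- exact: wB2_le.
- exact: wB2_cvg.
- exact: alsh.
- exact: alsh.
- exact: alshZ.
- exact: tlsh.
- exact: tush.
- exact: wB3_le.
- exact: wB3_cvg.
- exact: aush.
- exact: aush.
- exact: alshZ.
- exact: tush.
- exact: tlsh.
Qed.

End Difference.

Theorem theorem4p1 (R : realType) (q : R) (q_bound : -1 < q < 1) (q_neq0 : q != 0)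
    (A : cstarType R) (alpha beta : A) (A_SUq2 : is_C_SUq2 q alpha beta)
    (lambda : A -> endop R Gamma) (lambda_q : is_lambda_q q alpha beta lambda)
    (rho : A -> endop R (nat * int)%type) (rho_q : is_pi_q q alpha beta rho) :
  exists (U : bop (l2 R Gamma) (l2 R (nat * (nat * int))%type))
         (Us : bop (l2 R (nat * (nat * int))%type) (l2 R Gamma)),
    unitary_op U Us /\
    let p := (fun a => bcomp (bcomp U (lambda a)) Us,
              fun a => tens (bid (l2 R nat)) (rho a)) in
    quasihom (@toeplitz R) p /\ KK (@toeplitz R) (KK_class (@toeplitz R) p).
Proof.
exists (@U_Gamma R), (@Us_Gamma R); split; first exact: U_Gamma_unitary.
move=> p.
have [lambda_rep _ _] := lambda_q; have [rho_rep _ _] := rho_q.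
have p1_rep := unital_star_rep_conj (@U_Gamma_unitary R) lambda_rep.
have p2_rep := @unital_star_rep_tens _ _ nat _ _ rho_rep.
have diff a : adjointable_in_TK (p.1 a - p.2 a) ->
    spatial_tensor (@toeplitz R) (@compact_op R (nat * int)%type) (p.1 a - p.2 a) /\
    spatial_tensor (@toeplitz R) (@compact_op R (nat * int)%type) (p.1 (star a) - p.2 (star a)).
  move=> [X' adjX [KX KX']]; split => //.
  have [[_ _ p1_star] _] := p1_rep; have [[_ _ p2_star] _] := p2_rep.
  (* The difference at [star a] is an adjoint of the difference at a, hence equals X'. *)
  by rewrite (adjoint_op_uniq (adjoint_opB (p1_star a) (p2_star a)) adjX).
have [_ gen _] := A_SUq2.
(* [KK] consists by definition of the classes of quasihomomorphisms, so p itself witnesses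
   membership. *)
suff qp : quasihom (@toeplitz R) p by split => //; exists p.
apply: (quasihom_of_generators p1_rep p2_rep _ gen) => [a|a [->|->]].
- by apply: toeplitz_compact_multiplier; exact: toeplitz_bid.
- by apply: diff; exact: (alpha_difference_in_TK q_bound lambda_q rho_q).
- by apply: diff; exact: (beta_difference_in_TK q_bound lambda_q rho_q).
Qed.
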